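(* Let $f:\Omega\to\Omega'$ be an $L$-bilipschitz homeomorphism between planar domains ($L\geqslant1$). Then the rates of rotation satisfy the pointwise bound $$|\overline\gamma_f(z)|,\ |\underline\gamma_f(z)|\ \leqslant\ L-\frac1L,\qquad z\in\Omega .$$ This is best possible in general: for $\gamma\in\mathbb{R}$ the spiral map $s_\gamma(z)=z|z|^{i\gamma}$ of $\mathbb{D}$ is $L$-bilipschitz with $L-\frac1L=|\gamma|$, and it attains equality at $z=0$.
   Context: $f$ is $L$-bilipschitz if $\frac1L|x-y|\leqslant|f(x)-f(y)|\leqslant L|x-y|$ for all $x,y\in\Omega$. The upper and lower rates of rotation of a bilipschitz map are $$\overline\gamma_f(z)=\limsup_{r\to0^+}\frac{\arg(f(z+r)-f(z))}{\log r},\qquad \underline\gamma_f(z)=\liminf_{r\to0^+}\frac{\arg(f(z+r)-f(z))}{\log r},$$ with any continuous branch of $r\mapsto\arg(f(z+r)-f(z))$ for small $r>0$ (the values do not depend on the branch). $\mathbb{D}$ is the open unit disk and $s_\gamma(0)=0$. *)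

(* Defs.v *)
From HB Require Import structures.
From mathcomp Require Import all_boot all_order all_algebra.
From mathcomp Require Import complex.
From mathcomp Require Import all_classical all_reals all_analysis.

Set Implicit Arguments.
Unset Strict Implicit.
Unset Printing Implicit Defensive.

Import Order.TTheory GRing.Theory Num.Theory.
Import numFieldNormedType.Exports.

Local Open Scope classical_set_scope.
Local Open Scope ring_scope.

(* The complex plane is [Rcomplex R]: the type [R[i]] with its ring structure,
   seen as a real vector space with the R-valued modulus as norm.  The library
   stops at the norm; these instances add the topology of the modulus. *)
HB.instance Definition _ (R : realType) :=
  PseudoMetric.copy (Rcomplex R) (pseudoMetric_normed (Rcomplex R)).

HB.instance Definition _ (R : realType) :=
  isPointed.Build (Rcomplex R) 0.

HB.instance Definition _ (R : realType) :=
  NormedZmod_PseudoMetric_eq.Build R (Rcomplex R) erefl.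

Lemma Rcomplex_normZ (R : realType) (a : R) (z : Rcomplex R) :
  `|a *: z| = `|a| * `|z|.
Proof.
case: z => x y; rewrite /Num.norm /= !exprMn -mulrDr.
by rewrite sqrtrM ?sqr_ge0// sqrtr_sqr.
Qed.

HB.instance Definition _ (R : realType) :=
  PseudoMetricNormedZmod_Lmodule_isNormedModule.Build R (Rcomplex R)
    (@Rcomplex_normZ R).

Definition expi (R : realType) (t : R) : Rcomplex R := Complex (cos t) (sin t).

Definition planar_domain (R : realType) (U : set (Rcomplex R)) : Prop :=
  [/\ U !=set0, open U & connected U].

Definition homeomorphism_on (S T : topologicalType) (A : set S) (B : set T)
    (f : S -> T) : Prop :=
  [/\ set_bij A B f, {within A, continuous f} &
      exists2 g : T -> S, (forall x, A x -> g (f x) = x) &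
                          {within B, continuous g}].

Definition bilipschitz_on (R : realType) (L : R) (U : set (Rcomplex R))
    (f : Rcomplex R -> Rcomplex R) : Prop :=
  forall x y, U x -> U y ->
    L^-1 * `|x - y| <= `|f x - f y| /\ `|f x - f y| <= L * `|x - y|.

(* [theta] is a continuous branch of arg (f (z + r) - f z) for small r > 0;
   [r%:A] is the real number r as a complex number. *)
Definition arg_branch (R : realType) (f : Rcomplex R -> Rcomplex R)
    (z : Rcomplex R) (theta : R -> R) : Prop :=
  exists2 e : R, 0 < e &
    {in `]0, e[, continuous theta} /\
    forall r : R, 0 < r < e ->
      f (z + r%:A) - f z = `|f (z + r%:A) - f z| *: expi (theta r).

(* Branches exist and all of them give the same value: *)
Definition is_upper_rate (R : realType) (f : Rcomplex R -> Rcomplex R)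
    (z : Rcomplex R) (g : \bar R) : Prop :=
  (exists theta, arg_branch f z theta) /\
  forall theta, arg_branch f z theta ->
    limf_esup (fun r : R => (theta r / ln r)%:E) 0^'+ = g.

Definition is_lower_rate (R : realType) (f : Rcomplex R -> Rcomplex R)
    (z : Rcomplex R) (g : \bar R) : Prop :=
  (exists theta, arg_branch f z theta) /\
  forall theta, arg_branch f z theta ->
    limf_einf (fun r : R => (theta r / ln r)%:E) 0^'+ = g.

(* The default value is +oo, so that a finite bound on a rate also asserts that
   the rate is well defined. *)
Definition upper_rate (R : realType) (f : Rcomplex R -> Rcomplex R)
    (z : Rcomplex R) : \bar R :=
  xget +oo%E [set g | is_upper_rate f z g].

Definition lower_rate (R : realType) (f : Rcomplex R -> Rcomplex R)
    (z : Rcomplex R) : \bar R :=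
  xget +oo%E [set g | is_lower_rate f z g].

Definition unit_disk (R : realType) : set (Rcomplex R) := [set z | `|z| < 1].

(* z |z|^(i gamma) with |z|^(i gamma) = exp (i gamma log |z|); at z = 0 the
   factor z makes the value 0. *)
Definition spiral (R : realType) (gamma : R) (z : Rcomplex R) : Rcomplex R :=
  z * expi (gamma * ln `|z|).

(* Main.v *)
Require Import Defs.
From mathcomp Require Import all_boot all_order all_algebra.
From mathcomp Require Import complex.
From mathcomp Require Import all_classical all_reals all_analysis.
From mathcomp Require Import measurable_realfun zify ring lra.

Set Implicit Arguments.
Unset Strict Implicit.
Unset Printing Implicit Defensive.

Import Order.TTheory GRing.Theory Num.Theory.
Import numFieldNormedType.Exports.

Local Open Scope classical_set_scope.
Local Open Scope ring_scope.

(** The bound is a length-area argument in logarithmic coordinates.  After a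
    translation and a rescaling, f fixes 0 and is L-bilipschitz on the closed
    unit disc; write z = exp (t + i a) and f z = exp (U + i T), where T is a
    continuous lift of the argument ([exists_lift], [exists_log_map]).  The
    extremal map is the shear (t, a) |-> (t, a + (L - 1/L) t): it stretches the
    direction of slope 1/L most and sends it to the direction of slope L.
    Hence f is examined along logarithmic spirals of slope 1/L or -1/L, and the
    image is measured by the level U + L T or U - L T.

    Let the angle T turn by G along a radius over a range S of ln |z|.  Along a
    spiral the level changes by at least 2 S + L G - O(1) ([level_drop]): S
    comes from U, L G from the rotation, and another S from the slope of the
    spiral, because f winds a nonzero number of times around 0
    ([turning_number_neq0]).  In the other direction, take N equidistant spirals
    and cut them into cells of length a in ln |z|.  The discs of radius c |z|
    about points of different cells are disjoint for a suitable c, hence so are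
    the discs of radius c |z| / L about their images, by the lower Lipschitz
    bound alone ([slices_disjoint]).  Intersecting them with a line of constant
    level gives disjoint intervals in the range of ln |f|, whose length is
    S + O(1); integrating over the lines bounds an area and yields
    ([energy_bound])

      sum of (increment of the level over a cell)^2
        <= (1 + L^2)^2 a N (S + O(1)) (1 + small),

    where the upper Lipschitz bound enters through the increments
    ([level_step]).  Cauchy-Schwarz turns the two estimates into
    2 S + L G <= (1 + L^2) S + o(S), that is G <= (L - 1/L + o(1)) S.  Neither
    derivatives nor the area formula occur: lengths are sums of chords and areas
    are sums of disjoint intervals.

    The bound also asserts that the rates are well defined.  Branches exist by
    lifting, and two of them differ by a constant near 0, which ln r outweighs
    ([rates_of_branch]).

    For the spiral map, ln |z| and arg z become t and a + gamma t, and the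
    bilipschitz constant comes from the inequality [spiral_stretch], with the
    inverse being the spiral map of parameter - gamma.  Its branch at 0 is
    gamma ln r exactly. *)

(** * Inequalities between circular and hyperbolic functions *)

Section RealInequalities.
Context {R : realType}.
Implicit Types x y t : R.

Definition cosh x : R := (expR x + expR (- x)) / 2.
Definition sinh x : R := (expR x - expR (- x)) / 2.

Lemma cosh_sinh_sqr x : cosh x ^+ 2 = 1 + sinh x ^+ 2.
Proof. by rewrite /cosh /sinh; have := expRxMexpNx_1 x; nra. Qed.

Lemma cosh_half x : cosh x = 1 + 2 * sinh (x / 2) ^+ 2.
Proof.
have E : x = x / 2 + x / 2 by lra.
rewrite /cosh /sinh {1 2}E opprD !expRD.
by have := expRxMexpNx_1 (x / 2); nra.
Qed.

Lemma cos_half x : cos x = 1 - 2 * sin (x / 2) ^+ 2.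
Proof.
have E : x = x / 2 + x / 2 by lra.
by rewrite {1}E cosD; have := cos2Dsin2 (x / 2); nra.
Qed.

Lemma cosh_gt0 x : 0 < cosh x.
Proof. by rewrite divr_gt0// addr_gt0 ?expR_gt0. Qed.

Lemma coshN x : cosh (- x) = cosh x.
Proof. by rewrite /cosh opprK addrC. Qed.

Lemma sinhN x : sinh (- x) = - sinh x.
Proof. by rewrite /sinh opprK -mulNr opprB. Qed.

Lemma nonneg_derive_le (f df : R -> R) b : 0 <= b ->
  (forall x, is_derive x 1 f (df x)) ->
  (forall x, 0 <= x <= b -> 0 <= df x) -> f 0 <= f b.
Proof.
move=> b0 fdf df0.
have fc : {within `[0, b], continuous f}.
  apply: continuous_subspaceT => x; apply/differentiable_continuous.
  by apply/derivable1_diffP; have [] := fdf x.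
have [c + E] := MVT_segment b0 (fun x _ => fdf x) fc.
rewrite in_itv/= => /df0 dc.
by have := mulr_ge0 dc b0; lra.
Qed.

Lemma cosh_ge1 x : 1 <= cosh x.
Proof. by rewrite cosh_half lerDl mulr_ge0// sqr_ge0. Qed.

Lemma le_sinh x : 0 <= x -> x <= sinh x.
Proof.
move=> x0; rewrite -subr_ge0.
pose f y : R := sinh y - y.
suff : f 0 <= f x by rewrite /f /sinh !oppr0 subrr mul0r addr0 -/(sinh x) subr_ge0.
apply: (@nonneg_derive_le f (fun y => cosh y - 1)) => //.
  move=> y; rewrite /f /sinh /cosh; apply: is_derive_eq.
  by rewrite /GRing.scale/=; lra.
by move=> y _; rewrite subr_ge0 cosh_ge1.
Qed.

Lemma sqr_le_sinh x : x ^+ 2 <= sinh x ^+ 2.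
Proof.
wlog x0 : x / 0 <= x => [H|].
  have [|/ltW x0] := leP 0 x; first exact: H.
  by have := H (- x); rewrite sinhN !sqrrN oppr_ge0; apply.
by rewrite lerXn2r ?nnegrE// ?le_sinh// (le_trans x0) ?le_sinh.
Qed.

Lemma cosh_ge x : 1 + x ^+ 2 / 2 <= cosh x.
Proof. by rewrite cosh_half; have := sqr_le_sinh (x / 2); nra. Qed.

Lemma cosh_le x : cosh x - 1 <= x ^+ 2 / 2 * expR `|x|.
Proof.
wlog x0 : x / 0 <= x => [H|].
  have [|/ltW x0] := leP 0 x; first exact: H.
  by have := H (- x); rewrite coshN sqrrN normrN oppr_ge0; apply.
rewrite ger0_norm// cosh_half.
have S0 : 0 <= sinh (x / 2) by apply: le_trans (le_sinh _); lra.
have S : sinh (x / 2) <= x / 2 * expR (x / 2).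
  rewrite /sinh; have := expRxMexpNx_1 (x / 2).
  have := expR_ge1Dx (- (x / 2) - x / 2); rewrite expRD.
  by have := expR_gt0 (x / 2); have := expR_gt0 (- (x / 2)); nra.
have E : x = x / 2 + x / 2 by lra.
rewrite {3}E expRD.
have : sinh (x / 2) ^+ 2 <= (x / 2 * expR (x / 2)) ^+ 2.
  by rewrite lerXn2r ?nnegrE// (le_trans S0).
by have := expR_gt0 (x / 2); nra.
Qed.

Lemma sin_le x : 0 <= x -> sin x <= x.
Proof.
move=> x0; pose f y : R := y - sin y.
suff : f 0 <= f x by rewrite /f sin0 subrr subr_ge0.
apply: (@nonneg_derive_le f (fun y => 1 - cos y)) => //.
Qed.

Lemma sqr_sin_le x : sin x ^+ 2 <= x ^+ 2.
Proof.
have [x1|x1] := leP 1 `|x|.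
  have x2 : x ^+ 2 = `|x| ^+ 2 by rewrite real_normK ?num_real.
  by have := cos2Dsin2 x; have := sqr_ge0 (cos x); nra.
wlog x0 : x x1 / 0 <= x => [H|].
  have [|/ltW x0] := leP 0 x; first exact: H.
  by have := H (- x); rewrite sinN !sqrrN oppr_ge0 normrN; apply.
rewrite lerXn2r ?nnegrE// ?sin_le//.
rewrite ger0_norm// in x1.
apply: sin_ge0_pi; rewrite x0/= (le_trans (ltW x1))//.
by have := @pi_ge2 R; lra.
Qed.

Lemma cos_ge x : 1 - x ^+ 2 / 2 <= cos x.
Proof. by rewrite cos_half; have := sqr_sin_le (x / 2); nra. Qed.

Lemma mul_cos_le_sin x : 0 <= x <= pi -> x * cos x <= sin x.
Proof.
move=> /andP[x0 xpi]; pose f y : R := sin y - y * cos y.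
suff : f 0 <= f x by rewrite /f sin0 mul0r subrr subr_ge0.
apply: (@nonneg_derive_le f (fun y => y * sin y)) => //.
  by move=> y; rewrite /f; apply: is_derive_eq; rewrite /GRing.scale/=; lra.
move=> y /andP[y0 yx]; rewrite mulr_ge0// sin_ge0_pi// y0/=.
exact: le_trans xpi.
Qed.

Lemma sqr_mul_cos_le_sin x : `|x| <= pi / 2 ->
  x ^+ 2 * cos x ^+ 2 <= sin x ^+ 2.
Proof.
wlog x0 : x / 0 <= x => [H|].
  have [|/ltW x0] := leP 0 x; first exact: H.
  by have := H (- x); rewrite sinN cosN !sqrrN oppr_ge0 normrN; apply.
rewrite ger0_norm// => xpi.
have p0 := @pi_gt0 R.
have C0 : 0 <= cos x by apply: cos_ge0_pihalf; rewrite xpi andbT; lra.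
have S : x * cos x <= sin x by apply: mul_cos_le_sin; rewrite x0/=; lra.
rewrite -exprMn lerXn2r ?nnegrE// ?mulr_ge0//.
by rewrite (le_trans _ S)// mulr_ge0.
Qed.

(** This is |x| <= |tan x|. *)
Lemma sqr_cos_le x : `|x| <= pi / 2 -> cos x ^+ 2 * (1 + x ^+ 2) <= 1.
Proof. by move/sqr_mul_cos_le_sin; have := cos2Dsin2 x; nra. Qed.

Lemma sqr_cosh_ge x : 1 + x ^+ 2 <= cosh x ^+ 2.
Proof. by rewrite cosh_sinh_sqr lerD2l sqr_le_sinh. Qed.

End RealInequalities.

(** * Polar form and logarithmic coordinates *)

Section Polar.
Context {R : realType}.
Implicit Types (z w : Rcomplex R) (a b r s t u : R).

Lemma normC_sqr z : `|z| ^+ 2 = complex.Re z ^+ 2 + complex.Im z ^+ 2.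
Proof.
by case: z => x y; rewrite /Num.norm /= sqr_sqrtr// addr_ge0// sqr_ge0.
Qed.

Lemma ReB z w : complex.Re (z - w) = complex.Re z - complex.Re w.
Proof. by case: z; case: w. Qed.

Lemma ImB z w : complex.Im (z - w) = complex.Im z - complex.Im w.
Proof. by case: z; case: w. Qed.

Lemma norm_expi a : `|expi a| = 1.
Proof.
apply/eqP; rewrite -(@eqrXn2 _ 2)// expr1n normC_sqr /=.
by rewrite cos2Dsin2.
Qed.

Lemma dist_polar_sqr r a s b :
  `|r *: expi a - s *: expi b| ^+ 2 =
  r ^+ 2 + s ^+ 2 - 2 * r * s * cos (a - b).
Proof.
rewrite normC_sqr ReB ImB /= cosB.
have := cos2Dsin2 a; have := cos2Dsin2 b => Eb Ea.
transitivity (r ^+ 2 * (cos a ^+ 2 + sin a ^+ 2) +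
  s ^+ 2 * (cos b ^+ 2 + sin b ^+ 2) -
  2 * r * s * (cos a * cos b + sin a * sin b)); first by ring.
by rewrite Ea Eb !mulr1.
Qed.

Lemma polar_form z : exists a, z = `|z| *: expi a.
Proof.
have [->|z0] := eqVneq z 0; first by exists 0; rewrite normr0 scale0r.
have n0 : 0 < `|z| by rewrite normr_gt0.
case: z z0 n0 => x y z0 n0; set n := `|_| in n0 *.
have E : x ^+ 2 + y ^+ 2 = n ^+ 2 by rewrite normC_sqr.
have xn : -1 <= x / n <= 1.
  rewrite -ler_norml normrM normfV (gtr0_norm n0) ler_pdivrMr// mul1r.
  have x2 : `|x| ^+ 2 = x ^+ 2 by rewrite real_normK ?num_real.
  have := sqr_ge0 y; have := normr_ge0 x; nra.
pose a := acos (x / n).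
have Ca : cos a = x / n by rewrite acosK// in_itv.
have Sa : sin a ^+ 2 = (y / n) ^+ 2.
  rewrite sin2cos2 Ca !expr_div_n -E; field.
  by rewrite E expf_neq0// gt_eqF.
move/eqP: Sa; rewrite eqf_sqr => /orP[|] /eqP Sa.
- exists a; rewrite /expi Ca Sa.
  by congr Complex; rewrite mulrCA mulfV ?mulr1// gt_eqF.
- exists (- a); rewrite /expi cosN sinN Ca Sa opprK.
  by congr Complex; rewrite mulrCA mulfV ?mulr1// gt_eqF.
Qed.

Lemma angle_reduce a : exists n : int, `|a - 2 * pi * n%:~R| <= pi.
Proof.
have p0 := @pi_gt0 R.
exists (Num.floor ((a + pi) / (2 * pi))); set n := Num.floor _.
have p2 : 0 < 2 * pi :> R by lra.
have /andP[] := floor_itv ((a + pi) / (2 * pi)); rewrite -/n intrD.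
rewrite ler_pdivlMr// ltr_pdivrMr// => H1 H2.
by rewrite ler_norml; apply/andP; split; lra.
Qed.

Lemma cosD2pin a (n : int) : cos (a + 2 * pi * n%:~R) = cos a.
Proof.
have P : periodic cos (pi *+ 2 : R) by exact: cosD2pi.
have E (m : nat) : 2 * pi * m%:~R = pi *+ 2 *+ m :> R.
  by rewrite -[in RHS]mulr_natr -[pi *+ 2]mulr_natl.
case: n => m; first by rewrite E periodicn.
rewrite NegzE rmorphN mulrN E -[in LHS](periodicn P m.+1).
by rewrite subrK.
Qed.

Lemma sinD2pin a (n : int) : sin (a + 2 * pi * n%:~R) = sin a.
Proof.
have P : periodic sin (pi *+ 2 : R) by exact: sinD2pi.
have E (m : nat) : 2 * pi * m%:~R = pi *+ 2 *+ m :> R.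
  by rewrite -[in RHS]mulr_natr -[pi *+ 2]mulr_natl.
case: n => m; first by rewrite E periodicn.
rewrite NegzE rmorphN mulrN E -[in LHS](periodicn P m.+1).
by rewrite subrK.
Qed.

Lemma expiD2pin a (n : int) : expi (a + 2 * pi * n%:~R) = expi a.
Proof. by rewrite /expi cosD2pin sinD2pin. Qed.

Lemma cos_eq1 a : cos a = 1 -> exists n : int, a = 2 * pi * n%:~R.
Proof.
move=> C; have [n Hn] := angle_reduce a; exists n.
have C' : cos (a - 2 * pi * n%:~R) = 1.
  by rewrite -mulrN -rmorphN cosD2pin.
set b := a - _ in Hn C'.
have : cos `|b| = cos 0 by rewrite cos_norm cos0.
move/cos_inj; rewrite !in_itv /= normr_ge0 Hn lexx pi_ge0 => /(_ isT isT).
by move/normr0_eq0/eqP; rewrite /b subr_eq0 => /eqP.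
Qed.

Lemma expi_eq a b : expi a = expi b -> exists n : int, a = b + 2 * pi * n%:~R.
Proof.
move=> [C S]; have [|n E] := @cos_eq1 (a - b); last by exists n; lra.
by rewrite cosB C S -!expr2 cos2Dsin2.
Qed.

Lemma scale_expi_eq r s a b : 0 < r -> 0 < s -> r *: expi a = s *: expi b ->
  exists n : int, a = b + 2 * pi * n%:~R.
Proof.
move=> r0 s0 E; apply: expi_eq.
have rs : r = s.
  have := congr1 Num.norm E.
  by rewrite !normrZ !norm_expi !mulr1 !gtr0_norm.
by apply: (scalerI (lt0r_neq0 r0)); rewrite E rs.
Qed.

(** The complex exponential of t + i a. *)
Definition polar t a : Rcomplex R := expR t *: expi a.

Lemma norm_polar t a : `|polar t a| = expR t.
Proof. by rewrite normrZ norm_expi mulr1 gtr0_norm ?expR_gt0. Qed.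

(** Divided by the two moduli, the squared distance depends on the differences
    of the logarithmic coordinates only. *)
Lemma dist_polar t a u b :
  `|polar t a - polar u b| ^+ 2 = 2 * expR t * expR u * (cosh (t - u) - cos (a - b)).
Proof.
rewrite dist_polar_sqr /cosh opprB !expRD !expRN.
have := expR_gt0 t; have := expR_gt0 u => u0 t0.
by field; rewrite !gt_eqF.
Qed.

Lemma sum_polar t u :
  (expR t + expR u) ^+ 2 = 2 * expR t * expR u * (cosh (t - u) + 1).
Proof.
rewrite /cosh opprB !expRD !expRN.
have := expR_gt0 t; have := expR_gt0 u => u0 t0.
by field; rewrite !gt_eqF.
Qed.

Lemma norm_expi_sub a b : `|expi a - expi b| <= `|a - b|.
Proof.
have N2 : `|a - b| ^+ 2 = (a - b) ^+ 2 by rewrite real_normK ?num_real.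
have := dist_polar_sqr 1 a 1 b; rewrite !scale1r => D.
have := cos_ge (a - b); have := normr_ge0 (a - b).
by have := normr_ge0 (expi a - expi b); nra.
Qed.

End Polar.

(** * Lifting the argument *)

Section Lifting.
Context {R : realType}.
Implicit Types (z w : Rcomplex R) (a b r s t u : R).

Lemma Re_continuous : continuous (fun z : Rcomplex R => complex.Re z).
Proof.
move=> z; have FF : Filter (nbhs z) by exact: nbhs_filter.
apply/(@cvgrPdist_lt _ _ _ (nbhs z) FF) => e e0.
apply/nbhs_normP; exists e => //= w.
apply: le_lt_trans; rewrite -ReB.
rewrite -(@ler_pXn2r _ 2) ?nnegrE// real_normK ?num_real//.
by rewrite normC_sqr lerDl sqr_ge0.
Qed.

Lemma Im_continuous : continuous (fun z : Rcomplex R => complex.Im z).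
Proof.
move=> z; have FF : Filter (nbhs z) by exact: nbhs_filter.
apply/(@cvgrPdist_lt _ _ _ (nbhs z) FF) => e e0.
apply/nbhs_normP; exists e => //= w.
apply: le_lt_trans; rewrite -ImB.
rewrite -(@ler_pXn2r _ 2) ?nnegrE// real_normK ?num_real//.
by rewrite normC_sqr lerDr sqr_ge0.
Qed.

Lemma expi_atan_tan t : 0 < cos t -> expi (atan (tan t)) = expi t.
Proof.
move=> ct; set s := atan _.
have cs : 0 < cos s.
  by apply: cos_gt0_pihalf; rewrite atan_gtNpi2 atan_ltpi2.
have T : tan s = tan t by rewrite atanK.
have C : cos s = cos t.
  have E2 : cos s ^+ 2 = cos t ^+ 2.
    apply: (can_inj (@invrK _)).
    by rewrite (cos2_tan2 (lt0r_neq0 cs)) (cos2_tan2 (lt0r_neq0 ct)) T.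
  by apply/eqP; rewrite -(@eqrXn2 _ 2) ?ltW// E2.
have S u : 0 < cos u -> sin u = tan u * cos u.
  by move=> cu; rewrite /tan -mulrA mulVf ?mulr1// gt_eqF.
by rewrite /expi S// T C -S.
Qed.

(** The argument of z / w that lies between - pi / 2 and pi / 2, for z / w in the
    right half-plane. *)
Definition argq z w : R :=
  atan ((complex.Im z * complex.Re w - complex.Re z * complex.Im w) /
        (complex.Re z * complex.Re w + complex.Im z * complex.Im w)).

Lemma dot_gt0 z w : `|z - w| < `|w| ->
  0 < complex.Re z * complex.Re w + complex.Im z * complex.Im w.
Proof.
move=> zw; have w0 : 0 < `|w| by apply: le_lt_trans zw.
have : `|z - w| ^+ 2 < `|w| ^+ 2 by rewrite ltr_pXn2r ?nnegrE.
rewrite !normC_sqr ReB ImB.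
have := sqr_ge0 (complex.Re z); have := sqr_ge0 (complex.Im z); nra.
Qed.

Lemma argq_step z w b : `|z - w| < `|w| -> w = `|w| *: expi b ->
  z = `|z| *: expi (b + argq z w).
Proof.
move=> zw wb; have [a za] := polar_form z.
have D := dot_gt0 zw; rewrite /argq.
have w0 : 0 < `|w| by apply: le_lt_trans zw.
have z0 : 0 < `|z|.
  by rewrite normr_gt0; apply: contraTneq D => -> /=; rewrite !mul0r addr0 ltxx.
set n := `|w| in wb w0; set m := `|z| in za z0 *.
have Ez : complex.Re z = m * cos a /\ complex.Im z = m * sin a by rewrite za.
have Ew : complex.Re w = n * cos b /\ complex.Im w = n * sin b by rewrite wb.
move: D; rewrite Ez.1 Ez.2 Ew.1 Ew.2.
have -> : m * cos a * (n * cos b) + m * sin a * (n * sin b) =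
  m * n * cos (a - b) by rewrite cosB; ring.
have -> : m * sin a * (n * cos b) - m * cos a * (n * sin b) =
  m * n * sin (a - b) by rewrite sinB; ring.
have mn : 0 < m * n by rewrite mulr_gt0.
rewrite pmulr_rgt0// => C; rewrite -mulf_div divff ?gt_eqF// mul1r.
have [C' S'] := expi_atan_tan C.
have -> : expi (b + atan (sin (a - b) / cos (a - b))) = expi a; last exact: za.
rewrite -/(tan (a - b)) /expi cosD sinD C' S' -cosD -sinD.
by rewrite addrC subrK.
Qed.

Lemma argqxx z : argq z z = 0.
Proof. by rewrite /argq [X in X - _]mulrC subrr mul0r atan0. Qed.

Lemma argq_continuous (T : topologicalType) (f g : T -> Rcomplex R) x :
  {for x, continuous f} -> {for x, continuous g} -> `|f x - g x| < `|g x| ->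
  {for x, continuous (fun y => argq (f y) (g y))}.
Proof.
move=> cf cg fg; rewrite /argq.
have rf : complex.Re (f y) @[y --> x] --> complex.Re (f x).
  exact: (continuous_comp cf (@Re_continuous _)).
have rg : complex.Re (g y) @[y --> x] --> complex.Re (g x).
  exact: (continuous_comp cg (@Re_continuous _)).
have jf : complex.Im (f y) @[y --> x] --> complex.Im (f x).
  exact: (continuous_comp cf (@Im_continuous _)).
have jg : complex.Im (g y) @[y --> x] --> complex.Im (g x).
  exact: (continuous_comp cg (@Im_continuous _)).
pose q y := (complex.Im (f y) * complex.Re (g y) -
             complex.Re (f y) * complex.Im (g y)) /
            (complex.Re (f y) * complex.Re (g y) +
             complex.Im (f y) * complex.Im (g y)).
have cq : {for x, continuous q}.
  apply: cvgM; first by apply: cvgB; apply: cvgM.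
  apply: cvgV; first by rewrite gt_eqF// dot_gt0.
  by apply: cvgD; apply: cvgM.
have ca : {for q x, continuous (@atan R)} := @continuous_atan R _.
exact (@continuous_comp _ _ _ q (@atan R) x cq ca).
Qed.

Section Clamp.
Context {V : normedModType R} (d : R) (d0 : 0 < d).
Implicit Types p q : V.

(** Successive points on the way from 0 to p: each step has length at most d, and
    the sequence reaches p and stays there. *)
Definition clamp (k : nat) p : V :=
  Num.min 1 (k%:R * d / Num.max `|p| d) *: p.

Lemma clamp_den_gt0 p : 0 < Num.max `|p| d.
Proof. by rewrite lt_max d0 orbT. Qed.

Lemma clamp0 p : clamp 0 p = 0.
Proof. by rewrite /clamp mul0r mul0r min_r ?scale0r. Qed.

Lemma clamp_id k p : `|p| <= k%:R * d -> d <= k%:R * d -> clamp k p = p.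
Proof.
move=> pk dk; rewrite /clamp min_l ?scale1r// ler_pdivlMr ?clamp_den_gt0// mul1r.
by rewrite ge_max pk dk.
Qed.

Lemma clamp_step k p : `|clamp k.+1 p - clamp k p| <= d.
Proof.
rewrite /clamp -scalerBl normrZ; set m := Num.max _ _.
have m0 : 0 < m := clamp_den_gt0 p.
have pm : `|p| <= m by rewrite le_max lexx.
have dm : 0 <= d / m by rewrite divr_ge0// ltW.
have E : k.+1%:R * d / m = k%:R * d / m + d / m by rewrite -addn1 natrD; ring.
have M0 : `|Num.min 1 (k.+1%:R * d / m) - Num.min 1 (k%:R * d / m)| <= d / m.
  rewrite E ler_norml; set x := k%:R * d / m.
  by rewrite /Num.min; case: ifP; case: ifP; lra.
apply: (le_trans (ler_pM _ _ M0 pm)) => //.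
by rewrite mulfVK// gt_eqF.
Qed.

Lemma clamp_continuous k : continuous (clamp k).
Proof.
move=> p; apply: (@continuousZ _ _ _ (fun p => Num.min 1 (k%:R * d / Num.max `|p| d)) id); last exact: cvg_id.
apply: (@continuous_min R V (fun=> 1) (fun p => k%:R * d / Num.max `|p| d)).
  exact: cvg_cst.
apply: (@continuousM R V (fun=> k%:R * d) (fun p => (Num.max `|p| d)^-1)).
  exact: cvg_cst.
apply: (@continuousV R V (fun p => Num.max `|p| d)).
  by rewrite gt_eqF// clamp_den_gt0.
apply: (@continuous_max R V (fun p => `|p|) (fun=> d)).
  exact: norm_continuous.
exact: cvg_cst.
Qed.

End Clamp.

Section Lift.
Context {V : normedModType R} (F : V -> Rcomplex R) (d : R).
Hypotheses (d0 : 0 < d) (cF : continuous F)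
  (dF : forall p q, `|p - q| <= d -> `|F p - F q| < `|F q|).

(** Sums the arguments of the quotients of F at consecutive points of the way
    from 0 to p.  The terms vanish once p is reached, so that all large n give
    the same value. *)
Fixpoint lift_upto (b : R) (n : nat) (p : V) : R :=
  if n is k.+1 then
    lift_upto b k p + argq (F (clamp d k.+1 p)) (F (clamp d k p))
  else b.

Lemma lift_upto_continuous b n : continuous (lift_upto b n).
Proof.
elim: n => [|n IH] p /=; first exact: cvg_cst.
apply: (@continuousD _ _ _ (lift_upto b n)
  (fun p => argq (F (clamp d n.+1 p)) (F (clamp d n p)))); first exact: IH.
apply: argq_continuous; last by apply: dF; exact: clamp_step.
  by apply: (@continuous_comp _ _ _ (clamp d n.+1) F p);
    [exact: clamp_continuous | exact: cF].
by apply: (@continuous_comp _ _ _ (clamp d n) F p);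
  [exact: clamp_continuous | exact: cF].
Qed.

Lemma lift_uptoE b n p : F 0 = `|F 0| *: expi b ->
  F (clamp d n p) = `|F (clamp d n p)| *: expi (lift_upto b n p).
Proof.
move=> F0; elim: n => [|n IH]; first by rewrite clamp0.
by apply: argq_step => //; apply: dF; exact: clamp_step.
Qed.

Lemma lift_upto_stable b m n p : (m <= n)%N -> `|p| <= m%:R * d ->
  d <= m%:R * d -> lift_upto b n p = lift_upto b m p.
Proof.
elim: n => [|n IH]; first by rewrite leqn0 => /eqP ->.
rewrite leq_eqVlt ltnS => /predU1P[->//|mn] pm dm.
have mnd : m%:R * d <= n%:R * d by rewrite ler_pM2r// ler_nat.
have mnd' : m%:R * d <= n.+1%:R * d by rewrite ler_pM2r// ler_nat ltnW.
rewrite /= IH// !clamp_id// ?(le_trans pm)// ?(le_trans dm)//.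
by rewrite argqxx addr0.
Qed.

(** The step d being uniform, a number of steps sufficient for p is sufficient
    near p, where the lift is thus a finite sum of continuous functions. *)
Lemma exists_lift : exists2 th : V -> R, continuous th &
  forall p, F p = `|F p| *: expi (th p).
Proof.
have [b F0] := polar_form (F 0).
pose N (x : R) : nat := (Num.bound (x / d)).+1.
have NP x : 0 <= x -> x <= (N x)%:R * d /\ d <= (N x)%:R * d.
  move=> x0; have /archi_boundP H : 0 <= x / d by rewrite divr_ge0// ltW.
  rewrite /N -addn1 natrD; set m := (Num.bound _)%:R in H *.
  have m0 : 0 <= m by rewrite /m.
  have : x < m * d by rewrite -ltr_pdivrMr.
  by split; nra.
exists (fun p => lift_upto b (N `|p|) p); last first.
  move=> p; have [n1 n2] := NP `|p| (normr_ge0 _).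
  by have := @lift_uptoE b (N `|p|) p F0; rewrite clamp_id.
move=> p0; pose n := N (`|p0| + 1).
have E p : `|p| < `|p0| + 1 -> lift_upto b (N `|p|) p = lift_upto b n p.
  move=> pp; have [n1 n2] := NP `|p| (normr_ge0 _).
  have [m1 m2] := NP (`|p0| + 1) (addr_ge0 (normr_ge0 _) ler01).
  have [nm|/ltnW mn] := leqP (N `|p|) n.
    by rewrite [RHS](lift_upto_stable _ nm).
  by rewrite [LHS](lift_upto_stable _ mn)// ltW// (lt_le_trans pp).
rewrite /continuous_at E ?ltrDl//.
apply: (@cvg_trans _ (lift_upto b n p @[p --> p0]));
  last exact: lift_upto_continuous.
apply: near_eq_cvg; near=> p; rewrite E//.
have : `|p0 - p| < 1 by near: p; exact: cvgr_dist_lt.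
by move=> H; have := ler_distD p0 p 0; rewrite !subr0 distrC; lra.
Unshelve. all: by end_near. Qed.

End Lift.

End Lifting.

(** * Continuation of angles *)

Section AngleContinuation.
Context {R : realType}.
Implicit Types (a b x t : R).

(** An angle that leaves the open interval between - pi / 2 and pi / 2 passes
    through a zero of the cosine. *)
Lemma angle_lt_pihalf (g : R -> R) a b : a <= b ->
  {within `[a, b], continuous g} ->
  (forall x, a <= x <= b -> 0 < cos (g x - g a)) -> `|g b - g a| < pi / 2.
Proof.
move=> ab cg H; rewrite ltNge; apply/negP => far.
have p0 := @pi_gt0 R.
have [v vE vI] : exists2 v, cos (v - g a) = 0 &
    Num.min (g a) (g b) <= v <= Num.max (g a) (g b).
  have [gab|gba] := leP (g a) (g b).
    exists (g a + pi / 2); first by rewrite addrAC subrr add0r cos_pihalf.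
    by move: far; rewrite ger0_norm ?subr_ge0//; lra.
  exists (g a - pi / 2).
    by rewrite addrAC subrr add0r cosN cos_pihalf.
  by move: far; rewrite ltr0_norm ?subr_lt0//; lra.
have [c + cv] := IVT ab cg vI.
by rewrite in_itv/= => /H; rewrite cv vE ltxx.
Qed.

Lemma int_valued_const (g : R -> R) a b : a <= b ->
  {within `[a, b], continuous g} ->
  (forall x, a <= x <= b -> exists n : int, g x = g a + 2 * pi * n%:~R) ->
  g b = g a.
Proof.
move=> ab cg H; have p0 := @pi_gt0 R.
have : `|g b - g a| < pi / 2.
  apply: angle_lt_pihalf => // x /H[n ->].
  by rewrite addrC addKr -[_ * _]add0r cosD2pin cos0.
have [|n ->] := H b; first by rewrite ab lexx.
rewrite addrC addKr normrM gtr0_norm; last lra.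
have [-> |n0] := eqVneq n 0; first by rewrite mulr0 addr0.
have : 1 <= `|n%:~R| :> R.
  by rewrite -intr_norm ler1z; move: n0; rewrite -normr_gt0 gtz0_ge1.
nra.
Qed.

Context {V : normedModType R}.
Implicit Types p q : V.

Definition segm p q : R -> V := fun s => p + s *: (q - p).

Lemma segm_continuous p q : continuous (segm p q).
Proof.
move=> s; apply: cvgD; first exact: cvg_cst.
by apply: cvgZr_tmp; exact: cvg_id.
Qed.

Lemma segm_dist p q s : 0 <= s <= 1 -> `|segm p q s - p| <= `|q - p|.
Proof.
move=> /andP[s0 s1]; rewrite /segm addrC addKr normrZ ger0_norm//.
by rewrite ler_piMl.
Qed.

Lemma segm0 p q : segm p q 0 = p.
Proof. by rewrite /segm scale0r addr0. Qed.

Lemma segm1 p q : segm p q 1 = q.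
Proof. by rewrite /segm scale1r addrC subrK. Qed.

Lemma within_segm (g : V -> R) p q : continuous g ->
  {within `[0, 1], continuous (g \o segm p q)}.
Proof.
move=> cg; apply: continuous_subspaceT => s.
by apply: continuous_comp; [exact: segm_continuous | exact: cg].
Qed.

Lemma int_valued_const_normed (g : V -> R) p q : continuous g ->
  (forall p, exists n : int, g p = g q + 2 * pi * n%:~R) -> g p = g q.
Proof.
move=> cg H.
have := @int_valued_const (g \o segm q p) 0 1 ler01 (within_segm cg).
rewrite /= segm0 segm1; apply=> x _; exact: H.
Qed.

Lemma dot_polar (z w : Rcomplex R) a b : z = `|z| *: expi a ->
  w = `|w| *: expi b -> `|z - w| < `|w| -> 0 < cos (a - b).
Proof.
move=> za wb zw; have w0 : 0 < `|w| by apply: le_lt_trans zw.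
have : `|z - w| ^+ 2 < `|w| ^+ 2 by rewrite ltr_pXn2r ?nnegrE.
rewrite {1}za {1}wb dist_polar_sqr; have := normr_ge0 z.
set m := `|z|; set n := `|w| in w0 *; set c := cos _ => m0 H.
have m1 : 0 < m.
  rewrite lt_neqAle m0 andbT eq_sym; apply: contraTneq H => ->.
  by rewrite expr0n/=; lra.
have mn := mulr_gt0 m1 w0.
have : 0 < m * n * c by have := sqr_ge0 m; lra.
by rewrite pmulr_rgt0.
Qed.

Section LiftOscillation.
Variables (F : V -> Rcomplex R) (d : R) (th : V -> R).
Hypotheses (dF : forall p q, `|p - q| <= d -> `|F p - F q| < `|F q|)
  (cth : continuous th) (Fth : forall p, F p = `|F p| *: expi (th p)).

Lemma lift_step p q : `|p - q| <= d -> `|th p - th q| < pi / 2.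
Proof.
move=> pq; have := @angle_lt_pihalf (th \o segm q p) 0 1 ler01 (within_segm cth).
rewrite /= segm0 segm1; apply=> s s01.
apply: dot_polar (Fth _) (Fth _) _; apply: dF.
exact: le_trans (segm_dist _ _ s01) pq.
Qed.

Lemma lift_osc (n : nat) p q : 0 < d -> `|p - q| <= n%:R * d ->
  `|th p - th q| <= n%:R * (pi / 2).
Proof.
move=> d0; elim: n p => [|n IH] p.
  by rewrite !mul0r !normr_le0 !subr_eq0 => /eqP ->.
move=> pq; have n0 : 0 < n.+1%:R :> R by rewrite ltr0n.
pose q' := segm p q (n.+1%:R^-1).
have q1 : `|p - q'| <= d.
  rewrite /q' /segm opprD addrA subrr sub0r normrN normrZ gtr0_norm ?invr_gt0//.
  by rewrite distrC ler_pdivrMl.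
have q2 : `|q' - q| <= n%:R * d.
  have -> : q' - q = (1 - n.+1%:R^-1) *: (p - q).
    by rewrite /q' /segm scalerBl scale1r -[q - p]opprB scalerN addrAC.
  have -> : 1 - n.+1%:R^-1 = n%:R / n.+1%:R :> R.
    by apply: (mulIf (lt0r_neq0 n0)); rewrite mulfVK ?lt0r_neq0// mulrBl
      mul1r mulVf ?lt0r_neq0// -natr1 addrK.
  rewrite normrZ ger0_norm ?divr_ge0//.
  apply: le_trans (ler_wpM2l _ pq) _; first by rewrite divr_ge0.
  by rewrite mulrA mulfVK ?lt0r_neq0.
have := IH _ q2; have := lift_step q1.
have := ler_distD (th q') (th p) (th q).
rewrite -natr1; lra.
Qed.

End LiftOscillation.

End AngleContinuation.

(** * Bilipschitz maps of the disc in logarithmic coordinates *)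

Section PolarClose.
Context {R : realType}.

Lemma polar_close (t u a b : R) : `|t - u| <= 1 ->
  `|polar t a - polar u b| ^+ 2 <=
  expR u ^+ 2 * expR 1 * ((t - u) ^+ 2 * expR 1 + (a - b) ^+ 2).
Proof.
move=> tu; rewrite dist_polar.
have e1 : expR `|t - u| <= expR (1 : R) by rewrite ler_expR.
have e2 : expR t <= expR u * expR 1.
  by rewrite -expRD ler_expR; move: tu; rewrite ler_norml; lra.
have H1 := cosh_le (t - u); have H2 := cos_ge (a - b).
have H1' : cosh (t - u) - 1 <= (t - u) ^+ 2 / 2 * expR 1.
  by apply: le_trans H1 _; rewrite ler_wpM2l// divr_ge0// sqr_ge0.
have H3 : 2 * (cosh (t - u) - cos (a - b)) <=
  (t - u) ^+ 2 * expR 1 + (a - b) ^+ 2 by lra.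
have H4 : 0 <= cosh (t - u) - cos (a - b).
  by have := cosh_ge1 (t - u); have := cos_le1 (a - b); lra.
have -> : 2 * expR t * expR u * (cosh (t - u) - cos (a - b)) =
  expR t * (expR u * (2 * (cosh (t - u) - cos (a - b)))) by ring.
have -> : expR u ^+ 2 * expR 1 * ((t - u) ^+ 2 * expR 1 + (a - b) ^+ 2) =
  expR u * expR 1 * (expR u * ((t - u) ^+ 2 * expR 1 + (a - b) ^+ 2)) by ring.
apply: ler_pM => //; rewrite ?expR_ge0//.
  by rewrite !mulr_ge0// expR_ge0.
by rewrite ler_wpM2l ?expR_ge0.
Qed.

Definition polar_lip : R := expR 1 * (expR 1 + 1).

(** Over half this distance in logarithmic coordinates, an image point moves by
    less than its modulus; see [disk_image_step]. *)
Definition lift_scale (L : R) : R := (L ^+ 2 * polar_lip)^-1.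

Lemma expR1_ge2 : 2 <= expR (1 : R).
Proof. by have := expR_ge1Dx (1 : R); lra. Qed.

Lemma polar_lip_ge1 : 1 <= polar_lip.
Proof. by have := expR1_ge2; rewrite /polar_lip; nra. Qed.

Lemma polar_lip_gt0 : 0 < polar_lip.
Proof. exact: lt_le_trans polar_lip_ge1. Qed.

Lemma norm_min_sub (x y c : R) : `|Num.min x c - Num.min y c| <= `|x - y|.
Proof.
have N1 := ler_norm (x - y); have N2 : y - x <= `|x - y|.
  by rewrite distrC ler_norm.
rewrite /Num.min; case: ifP => [|/negbT]; case: ifP => [|/negbT];
  rewrite -?leNgt => H1 H2; rewrite ler_norml; apply/andP; split; lra.
Qed.

End PolarClose.

Lemma pair_continuous {R : realType} (X : topologicalType) (f g : X -> R) x :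
  {for x, continuous f} -> {for x, continuous g} ->
  {for x, continuous (fun y => (f y, g y))}.
Proof.
move=> cf cg.
exact: (@cvg_pair _ _ _ (nbhs x) (nbhs (f x)) (nbhs (g x)) _ _ _ f g cf cg).
Qed.

Section LogMap.
Context {R : realType}.
Variables (L rho : R) (h : Rcomplex R -> Rcomplex R).
Hypotheses (L1 : 1 <= L) (rho0 : 0 < rho) (h0 : h 0 = 0)
  (hbil : bilipschitz_on L [set z | `|z| <= 1] h)
  (hsurj : forall w : Rcomplex R, `|w| <= rho ->
     exists2 z : Rcomplex R, `|z| <= 1 & h z = w).

Local Notation V := (R * R)%type.
Implicit Types p q : V.

(** Cutting the radius off at 1 makes the composite with h a function on the whole
    plane of logarithmic coordinates, where arguments can be lifted along
    segments from the origin. *)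
Definition disk_pt p : Rcomplex R := polar (Num.min p.1 0) p.2.

Lemma disk_pt_le1 p : `|disk_pt p| <= 1.
Proof. by rewrite norm_polar expR_le1 ge_min lexx orbT. Qed.

Let L0 : 0 < L. Proof. exact: lt_le_trans L1. Qed.

Lemma modulus_bounds z : `|z| <= 1 -> L^-1 * `|z| <= `|h z| /\ `|h z| <= L * `|z|.
Proof.
move=> z1; have [] := hbil (x := z) (y := 0); rewrite /= ?normr0//.
by rewrite h0 !subr0.
Qed.

Local Notation F := (fun p => h (disk_pt p)).
Local Notation e := (expR (1 : R)).
Local Notation K := (@polar_lip R).

Lemma disk_image_close p q x : `|p - q| <= x -> x <= 1 ->
  `|F p - F q| <= L ^+ 2 * `|F q| * (K * x).
Proof.
move=> pq x1; have x0 : 0 <= x := le_trans (normr_ge0 _) pq.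
have [D1 D2] : `|p.1 - q.1| <= x /\ `|p.2 - q.2| <= x.
  by move: pq; rewrite prod_normE ge_max => /andP[].
have [_ H] := hbil (disk_pt_le1 p) (disk_pt_le1 q).
have [N _] := modulus_bounds (disk_pt_le1 q).
rewrite {1}norm_polar in N; set E := expR _ in N.
have E0 : 0 < E := expR_gt0 _.
have [m1 m2] : `|Num.min p.1 0 - Num.min q.1 0| <= 1 /\
   (Num.min p.1 0 - Num.min q.1 0) ^+ 2 <= x ^+ 2.
  have m := le_trans (norm_min_sub p.1 q.1 0) D1; split; first exact: le_trans m x1.
  by rewrite -[leLHS]real_normK ?num_real// lerXn2r ?nnegrE.
have m3 : (p.2 - q.2) ^+ 2 <= x ^+ 2.
  by rewrite -[leLHS]real_normK ?num_real// lerXn2r ?nnegrE.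
have P := polar_close p.2 q.2 m1; rewrite -/E in P.
have P' : `|disk_pt p - disk_pt q| ^+ 2 <= (E * (K * x)) ^+ 2.
  apply: le_trans P _.
  have -> : (E * (K * x)) ^+ 2 = E ^+ 2 * (e ^+ 2 * (e + 1) * (e + 1) * x ^+ 2).
    by rewrite /polar_lip; ring.
  rewrite -[leLHS]mulrA ler_wpM2l ?sqr_ge0//.
  have e0 := expR1_ge2.
  apply: (@le_trans _ _ (e * (x ^+ 2 * e + x ^+ 2))).
    by rewrite ler_wpM2l ?lerD// ?ler_wpM2r//; lra.
  have -> : e * (x ^+ 2 * e + x ^+ 2) = e * (e + 1) * x ^+ 2 * 1 by ring.
  have -> : e ^+ 2 * (e + 1) * (e + 1) * x ^+ 2 =
    e * (e + 1) * x ^+ 2 * (e * (e + 1)) by ring.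
  apply: ler_wpM2l; first by rewrite mulr_ge0 ?sqr_ge0//; nra.
  exact: polar_lip_ge1.
have k1 : 0 <= K := ltW polar_lip_gt0.
have k0 : 0 <= E * (K * x) := mulr_ge0 (ltW E0) (mulr_ge0 k1 x0).
have {}P' : `|disk_pt p - disk_pt q| <= E * (K * x) by rewrite -(@ler_pXn2r _ 2) ?nnegrE.
apply: le_trans H _.
have -> : L ^+ 2 * `|F q| * (K * x) = L * (L * `|F q| * (K * x)) by ring.
apply: (ler_wpM2l (ltW L0)); apply: le_trans P' _.
apply: (ler_wpM2r (mulr_ge0 k1 x0)).
by rewrite -ler_pdivrMl.
Qed.

Lemma disk_image_gt0 q : 0 < `|F q|.
Proof.
have [N _] := modulus_bounds (disk_pt_le1 q); apply: lt_le_trans N.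
by rewrite norm_polar mulr_gt0 ?invr_gt0 ?expR_gt0.
Qed.

Lemma lift_scale_gt0 : 0 < lift_scale L.
Proof. by rewrite invr_gt0 mulr_gt0 ?exprn_gt0// polar_lip_gt0. Qed.

Lemma disk_image_step p q : `|p - q| <= lift_scale L / 2 -> `|F p - F q| < `|F q|.
Proof.
move=> pq; have d0 := lift_scale_gt0; set d := lift_scale L in pq d0 *.
have LK : L ^+ 2 * K != 0 by rewrite -invr_eq0 gt_eqF.
have d1 : d <= 1.
  have LK1 : 1 <= L ^+ 2 * K := mulr_ege1 (exprn_ege1 2 L1) polar_lip_ge1.
  by rewrite /d /lift_scale invf_le1 ?(lt_le_trans ltr01).
apply: le_lt_trans (disk_image_close pq _) _; first lra.
have -> : L ^+ 2 * `|F q| * (K * (d / 2)) = `|F q| * ((L ^+ 2 * K) * d) / 2 by ring.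
by rewrite /d /lift_scale mulfV// mulr1; have := disk_image_gt0 q; lra.
Qed.

Lemma disk_image_continuous : continuous F.
Proof.
move=> q; have FF : Filter (nbhs q) by exact: nbhs_filter.
apply/(@cvgrPdist_lt _ _ _ (nbhs q) FF) => r r0.
pose M := L ^+ 2 * `|F q| * K.
have M0 : 0 < M := mulr_gt0 (mulr_gt0 (exprn_gt0 2 L0) (disk_image_gt0 q)) polar_lip_gt0.
pose x := Num.min 1 (r / (2 * M)).
have x0 : 0 < x by rewrite lt_min ltr01 divr_gt0// mulr_gt0.
near=> p.
have qp : `|p - q| < x by near: p; apply: cvgr_distC_lt => //; exact: cvg_id.
rewrite distrC.
apply: (@le_lt_trans _ _ (M * x)).
  rewrite /M -mulrA; apply: disk_image_close; first exact: ltW.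
  by rewrite /x ge_min lexx.
have hx : x <= r / (2 * M) by rewrite /x ge_min lexx orbT.
have Mx := mulr_gt0 M0 x0.
have M2 : 0 < 2 * M := mulr_gt0 (ltr0Sn _ _) M0.
move: hx; rewrite (ler_pdivlMr _ _ M2); 
have -> : x * (2 * M) = 2 * (M * x) by ring.
move: (M * x) Mx => y.
lra.
Unshelve. all: by end_near. Qed.

Lemma shift_periods (T : V -> R) (n : int) :
  (forall t a, T (t, a + 2 * pi) = T (t, a) + 2 * pi * n%:~R) ->
  forall (m : int) t a,
    T (t, a + 2 * pi * m%:~R) = T (t, a) + 2 * pi * (n * m)%:~R.
Proof.
move=> H.
have N (k : nat) t a : T (t, a + 2 * pi * k%:R) = T (t, a) + 2 * pi * n%:~R * k%:R.
  elim: k a => [|k IH] a; first by rewrite !mulr0 !addr0.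
  have -> : a + 2 * pi * k.+1%:R = (a + 2 * pi * k%:R) + 2 * pi.
    by rewrite -natr1; ring.
  by rewrite H IH -natr1; ring.
case=> k t a; first by rewrite intrM mulrA; exact: N.
rewrite NegzE intrM !mulrNz.
have := N k.+1 t (a + 2 * pi * - k.+1%:R).
have -> : a + 2 * pi * - k.+1%:R + 2 * pi * k.+1%:R = a by ring.
rewrite -[k.+1%:~R]/(k.+1%:R) => ->; ring.
Qed.

(** Invert h on a small circle and lift the preimage to logarithmic
    coordinates: the lift turns by some m periods while the image turns once,
    so the number of turns n of h over one period satisfies n m = 1. *)
Lemma turning_number_neq0 (T : V -> R) (n : int) : continuous T ->
  (forall p, F p = `|F p| *: expi (T p)) ->
  (forall t a, T (t, a + 2 * pi) = T (t, a) + 2 * pi * n%:~R) -> n != 0.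
Proof.
move=> cT FT Tn.
have [inv invP] : exists inv : R -> Rcomplex R, (forall a b, expi a = expi b -> inv a = inv b) /\
    forall a, `|inv a| <= 1 /\ h (inv a) = rho *: expi a.
  have H w : `|w| <= rho -> exists z, `|z| <= 1 /\ h z = w.
    by move=> /hsurj[z ? ?]; exists z.
  pose inv a : Rcomplex R := xget 0 [set z | `|z| <= 1 /\ h z = rho *: expi a].
  exists inv; split=> [a b E|a]; first by rewrite /inv E.
  have [|z zP] := H (rho *: expi a); last exact: (@xgetPex _ 0 [set z | `|z| <= 1 /\ h z = rho *: expi a] (ex_intro _ z zP)).
  by rewrite normrZ norm_expi mulr1 gtr0_norm.
case: invP => invE invP.
have inv_norm a : rho / L <= `|inv a|.
  have [i1 iE] := invP a; have [_] := modulus_bounds i1.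
  by rewrite iE normrZ norm_expi mulr1 gtr0_norm// ler_pdivrMr// mulrC.
have inv_gt0 a : 0 < `|inv a|.
  by apply: lt_le_trans (inv_norm a); rewrite divr_gt0.
have inv_lip a b : `|inv a - inv b| <= L * rho * `|a - b|.
  have [i1 iE] := invP a; have [j1 jE] := invP b; have [+ _] := hbil i1 j1.
  rewrite iE jE -scalerBr normrZ gtr0_norm// ler_pdivrMl// => H.
  apply: le_trans H _; rewrite -mulrA ler_pM2l// ler_pM2l//.
  exact: norm_expi_sub.
have ci : continuous inv.
  move=> a; have FF : Filter (nbhs a) by exact: nbhs_filter.
  apply/(@cvgrPdist_lt _ _ _ (nbhs a) FF) => e e0.
  have M0 : 0 < L * rho by rewrite mulr_gt0.
  near=> b; apply: le_lt_trans (inv_lip a b) _.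
  rewrite mulrC -ltr_pdivlMr//.
  near: b; apply: cvgr_dist_lt; first exact: cvg_id.
  by rewrite divr_gt0.
have [phi cphi phiE] : exists2 phi : R -> R, continuous phi &
    forall a, inv a = `|inv a| *: expi (phi a).
  pose d := (2 * L ^+ 2)^-1.
  have d0 : 0 < d by rewrite invr_gt0 mulr_gt0 ?exprn_gt0.
  apply: (@exists_lift R R^o inv d) => // a b ab.
  apply: (le_lt_trans (inv_lip a b)); apply: lt_le_trans (inv_norm b).
  have H : L * rho * `|a - b| <= L * rho * d.
    by rewrite ler_pM2l ?mulr_gt0.
  apply: le_lt_trans H _.
  have -> : L * rho * d = rho / L / 2.
    by rewrite /d; field; rewrite gt_eqF.
  by rewrite ltr_pdivrMr// ltr_pMr ?divr_gt0// ltrDl.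
pose tau a := ln `|inv a|.
have dE a : disk_pt (tau a, phi a) = inv a.
  have [i1 _] := invP a.
  rewrite /disk_pt /= min_l; last by rewrite ln_le0.
  by rewrite /polar lnK ?posrE// -phiE.
pose g a := T (tau a, phi a) - a.
have gZ a b : exists m : int, g a = g b + 2 * pi * m%:~R.
  have H c : exists m : int, T (tau c, phi c) = c + 2 * pi * m%:~R.
    have := FT (tau c, phi c); rewrite dE => E.
    have [_ hc] := invP c.
    apply: (@scale_expi_eq _ `|h (inv c)| rho); rewrite // ?hc ?normrZ ?norm_expi ?mulr1 ?gtr0_norm//.
    by rewrite -[in RHS]hc E hc normrZ norm_expi mulr1 gtr0_norm.
  have [m1 E1] := H a; have [m2 E2] := H b.
  by exists (m1 - m2); rewrite /g E1 E2 intrB; ring.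
have cg : continuous g.
  move=> a; apply: cvgB; last exact: cvg_id.
  have ct : {for a, continuous (fun a => (tau a, phi a))}.
    apply: (@pair_continuous _ _ tau phi); last exact: cphi.
    have cn : {for a, continuous (fun a => `|inv a|)}.
      by apply: (@continuous_comp _ _ _ inv (@Num.norm _ _)); [exact: ci|exact: norm_continuous].
    by apply: (@continuous_comp _ _ _ (fun a => `|inv a|) (@ln R)); [exact: cn|exact: continuous_ln].
  by apply: (@continuous_comp _ _ _ (fun a => (tau a, phi a)) T); [exact: ct|exact: cT].
have E : g (2 * pi) = g 0 := @int_valued_const_normed R R^o g (2 * pi) 0 cg (fun x => gZ x 0).
have iE : inv (2 * pi) = inv 0.
  by apply: invE; have := @expiD2pin R 0 1; rewrite mulr1 add0r.
have tE : tau (2 * pi) = tau 0 by rewrite /tau iE.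
have [m mE] : exists m : int, phi (2 * pi) = phi 0 + 2 * pi * m%:~R.
  have := phiE (2 * pi); rewrite iE [LHS]phiE.
  by move/esym/scale_expi_eq; apply.
move: E; rewrite /g tE mE (shift_periods Tn) subr0.
move=> E; apply/eqP => n0; move: E; rewrite n0 mul0r mulr0 addr0.
by have := @pi_gt0 R; lra.
Unshelve. all: by end_near. Qed.

(** The constant C is uniform in t: over a step of fixed length the lift moves by
    less than pi / 2, hence boundedly over one period of the angle, and whole
    periods contribute exactly n turns each. *)
Lemma exists_log_map : exists (U T : V -> R) (d C : R) (n : int),
  [/\ [/\ 0 < d, n != 0, continuous U & continuous T],
      forall p, F p = polar (U p) (T p),
      forall p q, `|p - q| <= d -> `|T p - T q| < pi / 2 &
      forall t a b, `|T (t, a) - T (t, b) - n%:~R * (a - b)| <= C].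
Proof.
have p0 := @pi_gt0 R.
pose d : R := lift_scale L / 2.
have d0 : 0 < d by rewrite divr_gt0// lift_scale_gt0.
have cF : continuous F by exact: disk_image_continuous.
have dF p q : `|p - q| <= d -> `|F p - F q| < `|F q|.
  exact: disk_image_step p q.
have F0 p : 0 < `|F p| by exact: disk_image_gt0 p.
have [T cT FT] := exists_lift d0 cF dF.
have step := @lift_step R V F d T dF cT FT.
have osc := @lift_osc R V F d T dF cT FT.
have dE t a : disk_pt (t, a + 2 * pi) = disk_pt (t, a).
  by rewrite /disk_pt /polar /=; have := expiD2pin a 1; rewrite mulr1 => ->.
have [n0 Tn] : exists n : int, forall t a, T (t, a + 2 * pi) = T (t, a) + 2 * pi * n%:~R.
  pose g p := T (p.1, p.2 + 2 * pi) - T p.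
  have gZ p : exists m : int, g p = 2 * pi * m%:~R.
    have := FT (p.1, p.2 + 2 * pi); rewrite dE -surjective_pairing.
    rewrite [LHS]FT => /scale_expi_eq-/(_ (F0 p) (F0 p))[m E].
    by exists (- m); rewrite /g mulrNz E; ring.
  have cg : continuous g.
    move=> p; apply: cvgB; last exact: cT.
    have ct : {for p, continuous (fun p : V => (p.1, p.2 + 2 * pi))}.
      apply: (@pair_continuous _ _ (fun p : V => p.1) (fun p : V => p.2 + 2 * pi)).
        exact: cvg_fst.
      by apply: cvgD; [exact: cvg_snd|exact: cvg_cst].
    by apply: (@continuous_comp _ _ _ (fun p : V => (p.1, p.2 + 2 * pi)) T);
      [exact: ct|exact: cT].
  have [m E0] := gZ (0, 0); exists m => t a.
  have : g (t, a) = g (0, 0).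
    apply: int_valued_const_normed => // p.
    have [k ->] := gZ p; exists (k - m); rewrite E0 intrB; ring.
  by rewrite E0 /g /= => <-; ring.
have n0_neq0 : n0 != 0 by exact: turning_number_neq0 cT FT Tn.
have SP := shift_periods Tn.
pose N : nat := Num.bound (2 * pi / d).
have NP : 2 * pi <= N%:R * d.
  by rewrite -ler_pdivrMr// ltW// archi_boundP// divr_ge0// ?ltW//; lra.
exists (fun p => ln `|F p|), T, d, (N%:R * (pi / 2) + `|n0%:~R| * (2 * pi)), n0.
split => //.
- split => // p.
  have cn : {for p, continuous (fun p => `|F p|)}.
    have nc := @norm_continuous _ (Rcomplex R).
    by apply: (@continuous_comp _ _ _ F (@Num.norm _ (Rcomplex R))); [exact: cF|exact: nc].
  by apply: (@continuous_comp _ _ _ (fun p => `|F p|) (@ln R)); [exact: cn|exact: continuous_ln].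
- by move=> p; rewrite /polar lnK ?posrE.
- move=> t a b.
  have [k kH] := angle_reduce a; have [m mH] := angle_reduce b.
  set a' := a - _ in kH; set b' := b - _ in mH.
  have -> : a = a' + 2 * pi * k%:~R by rewrite subrK.
  have -> : b = b' + 2 * pi * m%:~R by rewrite subrK.
  rewrite !SP !intrM.
  have -> : T (t, a') + 2 * pi * (n0%:~R * k%:~R) - (T (t, b') + 2 * pi * (n0%:~R * m%:~R)) -
     n0%:~R * (a' + 2 * pi * k%:~R - (b' + 2 * pi * m%:~R)) =
     (T (t, a') - T (t, b')) - n0%:~R * (a' - b') by ring.
  have ab : `|a' - b'| <= 2 * pi.
    by apply: le_trans (ler_normB _ _) _; lra.
  apply: le_trans (ler_normB _ _) _; apply: lerD.
    apply: osc => //; apply: le_trans NP; rewrite prod_normE/= subrr normr0.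
    by rewrite ge_max ab andbT; lra.
  by rewrite normrM ler_wpM2l.
Qed.

End LogMap.

(** * Packing intervals and averaging *)

Section Averaging.
Context {R : realType}.

(** Integrate the sum of the indicators of the intervals, weighted by w. *)
Lemma sum_overlap_le (I : finType) (w lo hi : I -> R) (A B S : R) :
  A <= B -> (forall i, 0 <= w i) ->
  (forall x, A < x < B -> \sum_(i | lo i < x < hi i) w i <= S) ->
  \sum_i w i * Num.max 0 (Num.min (hi i) B - Num.max (lo i) A) <= S * (B - A).
Proof.
move=> AB w0 H.
pose J i : set R := [set` `]Num.max (lo i) A, Num.min (hi i) B[].
pose D : set R := [set` `]A, B[].
have mJ i : measurable (J i) by exact: measurable_itv.
have mD : measurable D by exact: measurable_itv.
have JE i x : D x -> (x \in J i) = (lo i < x < hi i).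
  rewrite /D /J /= in_itv/= => /andP[Ax xB].
  apply/idP/idP; rewrite inE /= in_itv/= gt_max lt_min Ax xB !andbT//.
have muJ i : lebesgue_measure (D `&` J i) =
    (Num.max 0 (Num.min (hi i) B - Num.max (lo i) A))%:E.
  have -> : D `&` J i = J i.
    apply/setIidPr => x; rewrite /D /J /= !in_itv/= gt_max lt_min.
    by move=> /andP[/andP[_ ->] /andP[_ ->]].
  rewrite /J lebesgue_measure_itv/= lte_fin.
  set lo' := Num.max (lo i) A; set hi' := Num.min (hi i) B.
  case: ltP => h; last by rewrite max_l// subr_le0.
  rewrite -EFinB; congr EFin; rewrite [in RHS]max_r// subr_ge0.
  exact: ltW.
pose g i x := (w i * \1_(J i) x)%:E.
have mg i : measurable_fun D (g i).
  apply/measurable_EFinP.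
  apply: measurable_funM; first exact: measurable_cst.
  exact: measurable_indic.
have g0 i x : D x -> (0 <= g i x)%E by move=> _; rewrite lee_fin mulr_ge0.
have : (\int[lebesgue_measure]_(x in D) (\sum_(i <- index_enum I) g i x) <=
        \int[lebesgue_measure]_(x in D) (cst S%:E x))%E.
  apply: ge0_le_integral => //.
  - by move=> x Dx; apply: sume_ge0 => i _; apply: g0.
  - exact: emeasurable_sum.
  - move=> x Dx; rewrite sumEFin lee_fin; have := H x.
    move: (Dx); rewrite {1}/D /= in_itv/= => xAB /(_ xAB); apply: le_trans.
    rewrite [leRHS]big_mkcond; apply: ler_sum => i _ /=.
    by rewrite indicE JE//; case: ifP; rewrite ?mulr1 ?mulr0.
have muD : lebesgue_measure D = (B - A)%:E.
  rewrite /D lebesgue_measure_itv/= lte_fin.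
  case: ltP => // BA.
  by have -> : A = B by [apply/eqP; rewrite eq_le AB]; rewrite subrr.
rewrite integral_cst// ge0_integral_sum//.
rewrite [X in (_ <= _ * X)%E](_ : _ = (B - A)%:E); last exact: muD.
rewrite -EFinM.
rewrite [X in (X <= _)%E](eq_bigr
   (fun i => (w i * Num.max 0 (Num.min (hi i) B - Num.max (lo i) A))%:E)).
  by rewrite sumEFin lee_fin.
move=> i _.
have wi : w i < 0 -> J i = set0 by rewrite ltNge w0.
transitivity ((w i)%:E *
    \int[lebesgue_measure]_(x in D) (\1_(J i) x)%:E)%E.
  rewrite /g; have E := @integralZl_indic _ _ R lebesgue_measure D mD (fun=> J i) (w i) wi (mJ i).
  exact: E.
rewrite EFinM; congr (_ * _)%E; rewrite -muJ setIC.
exact: (integral_indic lebesgue_measure mD (mJ i)).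
Qed.

(** Averaging with weights 1: at most one of disjoint intervals contains a given
    point. *)
Lemma packing (I : finType) (act : pred I) (c z : I -> R) (A B : R) :
  A <= B -> (forall i, act i -> [/\ 0 <= z i, A <= c i - z i & c i + z i <= B]) ->
  (forall i j v, act i -> act j -> i != j ->
     `|v - c i| < z i -> `|v - c j| < z j -> False) ->
  \sum_(i | act i) 2 * z i <= B - A.
Proof.
move=> AB zP dis.
have := @sum_overlap_le I (fun i => (act i)%:R) (fun i => c i - z i)
  (fun i => c i + z i) A B 1 AB (fun=> ler0n _ _).
rewrite mul1r => H; apply: le_trans (H _) => [|x _].
  rewrite big_mkcond; apply: ler_sum => i _; case: ifP => ai; last first.
    by rewrite mul0r.
  have [z0 zA zB] := zP i ai.
  rewrite mul1r (min_l zB) (max_l zA).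
  by rewrite le_max; apply/orP; right; lra.
set Q := fun i => c i - z i < x < c i + z i.
have [/existsP[i /andP[Qi ai]]|none] := boolP [exists i, Q i && act i].
  rewrite (bigD1 i)//= ai big1 ?addr0// => j /andP[Qj ji].
  case aj : (act j) => //; exfalso.
  apply: (dis j i x aj ai ji); rewrite ltr_norml;
    [move: Qj|move: Qi]; rewrite /Q => /andP[? ?]; apply/andP; split; lra.
rewrite big1// => i Qi; case ai : (act i) => //.
by case/existsP: none; exists i; rewrite /Q Qi ai.
Qed.

Lemma minmaxP (y P : R) : 0 <= P ->
  [\/ y <= 0 /\ Num.min (Num.max y 0) P = 0,
      0 <= y <= P /\ Num.min (Num.max y 0) P = y |
      P <= y /\ Num.min (Num.max y 0) P = P].
Proof.
move=> P0; have [y0|y0] := leP y 0.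
  by constructor 1; split => //; rewrite min_l.
have [yP|yP] := leP y P; last by constructor 3; split => //; exact: ltW.
by constructor 2; split => //; rewrite (ltW y0).
Qed.

Lemma overlap_minmax (P l h : R) : 0 <= P -> l <= h ->
  Num.max 0 (Num.min h P - Num.max l 0) =
  Num.min (Num.max h 0) P - Num.min (Num.max l 0) P.
Proof.
move=> P0 hl.
have := minmaxP h P0; have := minmaxP l P0.
set ch := Num.min (Num.max h 0) P; set cl := Num.min (Num.max l 0) P.
move=> Hl Hh.
have {}Hl : [\/ l <= 0 /\ cl = 0 /\ Num.max l 0 = 0,
    0 <= l <= P /\ cl = l /\ Num.max l 0 = l | P <= l /\ cl = P /\ Num.max l 0 = l].
  case: Hl => -[H ->]; [constructor 1|constructor 2|constructor 3];
    do 2 split => //; [rewrite max_r| rewrite max_l| rewrite max_l]; lra.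
have {}Hh : [\/ h <= 0 /\ ch = 0 /\ Num.min h P = h,
    0 <= h <= P /\ ch = h /\ Num.min h P = h | P <= h /\ ch = P /\ Num.min h P = P].
  case: Hh => -[H ->]; [constructor 1|constructor 2|constructor 3];
    do 2 split => //; [rewrite min_l| rewrite min_l| rewrite min_r]; lra.
clearbody ch cl.
case: Hl => -[? [-> ->]]; case: Hh => -[? [-> ->]];
  by [rewrite max_r; lra | rewrite max_l; lra].
Qed.

Lemma sum_minmax (P y : R) (n : nat) : 0 < P ->
  \sum_(m < n) Num.min (Num.max (y - P * m%:R) 0) P =
  Num.min (Num.max y 0) (P * n%:R).
Proof.
move=> P0; elim: n => [|n IH].
  by rewrite big_ord0 mulr0 min_r// le_max lexx orbT.
rewrite big_ord_recr /= IH -natr1 mulrDr mulr1.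
have n0 : 0 <= P * n%:R by rewrite mulr_ge0// ltW.
set x := P * n%:R in n0 *.
have [] := minmaxP (y - x) (ltW P0); have [] := minmaxP y n0;
  have [] := minmaxP y (addr_ge0 n0 (ltW P0)).
all: by move=> [? ->] [? ->] [? ->]; lra.
Qed.

(** The translates of ]0, P[ by multiples of P tile the line up to endpoints. *)
Lemma overlap_shift_sum (P lo hi : R) (B : nat) : 0 < P -> lo <= hi ->
  - (P * B%:R) <= lo -> hi <= P * B%:R ->
  \sum_(m < B + B) Num.max 0 (Num.min (hi - P * (m%:R - B%:R)) P -
                              Num.max (lo - P * (m%:R - B%:R)) 0) = hi - lo.
Proof.
move=> P0 lh lB hB.
pose k y := Num.min (Num.max y 0) P.
have E (m : 'I_(B + B)) : Num.max 0 (Num.min (hi - P * (m%:R - B%:R)) P -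
    Num.max (lo - P * (m%:R - B%:R)) 0) =
    k (hi + P * B%:R - P * m%:R) - k (lo + P * B%:R - P * m%:R).
  have S y : y - P * (m%:R - B%:R) = y + P * B%:R - P * m%:R by ring.
  rewrite !S.
  by apply: overlap_minmax; [exact: ltW|lra].
under eq_bigr do rewrite E.
rewrite sumrB /k !sum_minmax// natrD mulrDr.
rewrite !max_l ?min_l; lra.
Qed.

End Averaging.

(** * Levels along logarithmic spirals *)

Section StepBounds.
Context {R : realType}.
Implicit Types x y : R.

Lemma normr_half x : `|x / 2| = `|x| / 2.
Proof. by rewrite normrM normfV normr_nat. Qed.

(** Here 2 (cosh x - cos y) is a squared chord divided by the moduli of its ends,
    and (x, y) is the step in logarithmic coordinates: the chord is as long as the
    step up to a factor that tends to 1 as the chord shrinks. *)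
Lemma step_bound x y : `|y| <= pi ->
  (x ^+ 2 + y ^+ 2) * (1 - 2 * (cosh x - cos y) / 4) <= 2 * (cosh x - cos y).
Proof.
move=> ypi.
have A := cosh_ge x.
have y2 : `|y / 2| <= pi / 2 by rewrite normr_half; lra.
have B := sqr_mul_cos_le_sin y2.
have C := cos_half y; have CS := cos2Dsin2 (y / 2).
rewrite C.
set S := sin _ in B C CS *; set c := cos (y / 2) in B CS.
have c2 : c ^+ 2 = 1 - S ^+ 2 by lra.
rewrite c2 in B; have C1 := cosh_ge1 x; have x2 := sqr_ge0 x.
have y22 := sqr_ge0 y; have S2 := sqr_ge0 S.
have E : 2 * (cosh x - (1 - 2 * S ^+ 2)) / 4 = (cosh x - 1) / 2 + S ^+ 2 by field.
rewrite E; set h := cosh x in A C1 *.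
have H1 : x ^+ 2 * (1 - ((h - 1) / 2 + S ^+ 2)) <= x ^+ 2 by nra.
have H2 : y ^+ 2 * (1 - ((h - 1) / 2 + S ^+ 2)) <= y ^+ 2 * (1 - S ^+ 2) by nra.
rewrite mulrDl; lra.
Qed.

(** With x = tau / 2 and y = psi / 2, the squared quotient of the chord by the sum
    of the moduli is 1 - cos^2 y / cosh^2 x, and cosh^2 x >= 1 + x^2 while
    cos^2 y <= 1 / (1 + y^2).  So it is at least r / (1 + r) when
    r <= x^2 + y^2. *)
Lemma separation_bound (tau psi r : R) : `|psi| <= pi -> 0 <= r ->
  4 * r <= tau ^+ 2 + psi ^+ 2 ->
  r * (cosh tau + 1) <= (1 + r) * (cosh tau - cos psi).
Proof.
move=> psipi r0 H.
have y2 : `|psi / 2| <= pi / 2 by rewrite normr_half; lra.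
have C := sqr_cos_le y2; have S := sqr_cosh_ge (tau / 2).
have Ch := cosh_half tau; have Cs := cosh_sinh_sqr (tau / 2).
have Cp := cos_half psi; have CS := cos2Dsin2 (psi / 2).
set k := cosh (tau / 2) ^+ 2 in S Cs; set l := cos (psi / 2) ^+ 2 in C CS.
have -> : cosh tau + 1 = 2 * k by lra.
have -> : cosh tau - cos psi = 2 * (k - l) by lra.
have l0 : 0 <= l := sqr_ge0 _.
have : r <= (tau / 2) ^+ 2 + (psi / 2) ^+ 2 by lra.
set x2 := (tau / 2) ^+ 2 in S *; set y2' := (psi / 2) ^+ 2 in C *.
have x0 : 0 <= x2 := sqr_ge0 _; have y0 : 0 <= y2' := sqr_ge0 _.
move=> rxy.
suff : (1 + r) * l <= k by lra.
have H1 : (1 + r) * l <= (1 + x2 + y2') * l by rewrite ler_wpM2r//; lra.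
have H2 : (1 + x2 + y2') * l <= (1 + x2) * (1 + y2') * l.
  by rewrite ler_wpM2r//; nra.
have H3 : (1 + x2) * (l * (1 + y2')) <= (1 + x2) * 1 by rewrite ler_wpM2l//; lra.
lra.
Qed.

End StepBounds.

Lemma ord_sub_multiple (N : nat) (i j : 'I_N) (c : int) :
  (i : int) - (j : int) - c * (N : int) = 0 -> c = 0 /\ i = j.
Proof.
have iN := ltn_ord i; have jN := ltn_ord j => E.
have c0 : c = 0 by nia.
split=> //; apply: ord_inj; move: E; rewrite c0 mul0r subr0 => /eqP.
by rewrite subr_eq0 => /eqP[].
Qed.

Lemma within_cell {R : realDomainType} (lo hi a d x y : R) :
  lo = hi - a + d -> 0 < d -> lo <= x <= hi -> lo <= y <= hi -> `|x - y| <= a.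
Proof.
move=> lE d0 /andP[? ?] /andP[? ?]; rewrite ler_norml.
by apply/andP; split; lra.
Qed.

Lemma norms_bound {R : realDomainType} (x y b : R) :
  `|x| + `|y| <= b -> - b <= x /\ y <= b.
Proof.
have := ler_norm (- x); have := ler_norm y; rewrite normrN.
by have := normr_ge0 x; have := normr_ge0 y; split; lra.
Qed.

Lemma slice_range {R : realDomainType} (l S t u z : R) :
  `|u - t| <= l -> - S <= t -> t <= 0 -> z <= 1 ->
  - S - l - 1 <= u - z /\ u + z <= l + 1.
Proof. by rewrite ler_norml => /andP[? ?] ? ? ?; split; lra. Qed.

Lemma slice_range_le {R : realDomainType} (l S : R) :
  0 <= l -> 0 <= S -> - S - l - 1 <= l + 1.
Proof. by move=> ? ?; lra. Qed.

Lemma cells_apart {R : realDomainType} (a d t x y : R) :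
  x <= - ((t + 1) * a) -> - (t * a) - a + d <= y -> d <= `|x - y|.
Proof. by move=> ? ?; rewrite distrC; apply: le_trans (ler_norm _); lra. Qed.

Section LogGeometry.
Context {R : realType}.
Local Notation V := (R * R)%type.
Variables (L : R) (U T : V -> R) (d0 sg s : R).
Hypotheses (L1 : 1 <= L) (d00 : 0 < d0) (sg2 : sg ^+ 2 = 1) (s2 : s ^+ 2 = 1).
Implicit Types p q : V.

Local Notation src p := (polar p.1 p.2).
Local Notation img p := (polar (U p) (T p)).

Hypotheses
  (img_le : forall p q, p.1 <= 0 -> q.1 <= 0 ->
     `|img p - img q| <= L * `|src p - src q|)
  (img_ge : forall p q, p.1 <= 0 -> q.1 <= 0 ->
     `|src p - src q| <= L * `|img p - img q|)
  (U_close : forall p, p.1 <= 0 -> `|U p - p.1| <= ln L)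
  (T_step : forall p q, `|p - q| <= d0 -> `|T p - T q| < pi / 2).

Let L0 : 0 < L. Proof. exact: lt_le_trans L1. Qed.

(** The spirals have slope 1 / L or - 1 / L, according to s; this is the direction
    that the extremal shear stretches most. *)
Definition spiral_pt (phi t : R) : V := (t, phi + s * t / L).
(** Up to the sign sg, the coordinate U + sg L T along the image of that
    direction.  In this form the line where the level is x has
    T = (x - sg U) / L, and a period of T changes the level by 2 pi L. *)
Definition level p : R := sg * U p + L * T p.
(** The modulus of a point divided by the modulus of its image. *)
Definition dilat p : R := expR (p.1 - U p).

Lemma dilat_le p : p.1 <= 0 -> dilat p <= L.
Proof.
move=> /U_close; rewrite ler_norml => /andP[h _].
by rewrite -[leRHS](lnK _) ?posrE// ler_expR; lra.
Qed.

(** The squared distance of two image points divided by their moduli. *)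
Definition gap2 p q : R := 2 * (cosh (U p - U q) - cos (T p - T q)).

Lemma gap2_ge0 p q : 0 <= gap2 p q.
Proof.
by have := cosh_ge1 (U p - U q); have := cos_le1 (T p - T q); rewrite /gap2; lra.
Qed.

Lemma gap2_le phi t u a : t <= 0 -> u <= 0 -> `|t - u| <= a -> a <= 1 ->
  gap2 (spiral_pt phi t) (spiral_pt phi u) <=
  (1 + L ^+ 2) * expR a * a ^+ 2 *
  (dilat (spiral_pt phi t) * dilat (spiral_pt phi u)).
Proof.
move=> t0 u0 tu a1; have a0 : 0 <= a := le_trans (normr_ge0 _) tu.
set p := spiral_pt phi t; set q := spiral_pt phi u.
have := img_le (p := p) (q := q) t0 u0.
rewrite -(@ler_pXn2r _ 2) ?nnegrE ?mulr_ge0 ?(ltW L0)//.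
rewrite exprMn !dist_polar /= => H.
have tu2 : (t - u) ^+ 2 <= a ^+ 2.
  by rewrite -[leLHS]real_normK ?num_real// lerXn2r ?nnegrE.
have ea : expR `|t - u| <= expR a by rewrite ler_expR.
have ea1 : 1 <= expR a by rewrite -expR0 ler_expR.
have hq : 2 * (cosh (t - u) - cos (phi + s * t / L - (phi + s * u / L))) <=
    a ^+ 2 * expR a * (1 + L ^- 2).
  have -> : phi + s * t / L - (phi + s * u / L) = s * (t - u) / L by ring.
  have h1 := cosh_le (t - u); have h2 := cos_ge (s * (t - u) / L).
  have e1 : (s * (t - u) / L) ^+ 2 = (t - u) ^+ 2 * L ^- 2.
    by rewrite !exprMn s2 mul1r exprVn.
  rewrite e1 in h2.
  have Li : 0 <= L ^- 2 by rewrite invr_ge0 sqr_ge0.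
  have k1 : (t - u) ^+ 2 * expR `|t - u| <= a ^+ 2 * expR a.
    by apply: ler_pM => //; exact: sqr_ge0.
  have k2 : (t - u) ^+ 2 * L ^- 2 <= a ^+ 2 * expR a * L ^- 2.
    rewrite ler_wpM2r//; apply: le_trans tu2 _.
    by rewrite ler_peMr// sqr_ge0.
  lra.
rewrite -/(gap2 p q) /dilat /= !expRB.
set eU := expR (U p) in H *; set eU' := expR (U q) in H *.
have U0 : 0 < eU := expR_gt0 _. have U1 : 0 < eU' := expR_gt0 _.
have T0 := expR_gt0 t; have T1 := expR_gt0 u.
have H' : eU * eU' * gap2 p q <= L ^+ 2 * (expR t * expR u) *
    (a ^+ 2 * expR a * (1 + L ^- 2)).
  have -> : eU * eU' * gap2 p q = 2 * eU * eU' * (cosh (U p - U q) - cos (T p - T q)).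
    by rewrite /gap2; ring.
  apply: le_trans H _.
  have -> : L ^+ 2 * (2 * expR t * expR u * (cosh (t - u) -
      cos (phi + s * t / L - (phi + s * u / L)))) = L ^+ 2 * (expR t * expR u) *
     (2 * (cosh (t - u) - cos (phi + s * t / L - (phi + s * u / L)))) by ring.
  by rewrite ler_wpM2l// !mulr_ge0 ?sqr_ge0// ltW.
have -> : (1 + L ^+ 2) * expR a * a ^+ 2 * (expR t / eU * (expR u / eU')) =
  L ^+ 2 * (expR t * expR u) * (a ^+ 2 * expR a * (1 + L ^- 2)) / (eU * eU').
  by field; rewrite !gt_eqF.
by rewrite ler_pdivlMr ?mulr_gt0// mulrC.
Qed.

Definition gap_const : R := (1 + L ^+ 2) * expR 1 * L ^+ 2.

Lemma gap2_le_sqr phi t u a : t <= 0 -> u <= 0 -> `|t - u| <= a -> a <= 1 ->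
  gap2 (spiral_pt phi t) (spiral_pt phi u) <= gap_const * a ^+ 2.
Proof.
move=> t0 u0 tu a1; apply: le_trans (gap2_le _ t0 u0 tu a1) _.
have a0 : 0 <= a := le_trans (normr_ge0 _) tu.
have ea : expR a <= expR 1 by rewrite ler_expR.
have D1 := @dilat_le (spiral_pt phi t) t0.
have D2 := @dilat_le (spiral_pt phi u) u0.
set x := dilat _ in D1 *; set y := dilat _ in D2 *.
have x0 : 0 <= x := expR_ge0 _. have y0 : 0 <= y := expR_ge0 _.
have xy : x * y <= L ^+ 2 by rewrite expr2 ler_pM.
have -> : gap_const * a ^+ 2 = (1 + L ^+ 2) * expR 1 * a ^+ 2 * L ^+ 2 by rewrite /gap_const; ring.
apply: ler_pM => //; rewrite ?mulr_ge0 ?expR_ge0 ?sqr_ge0//.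
  by rewrite addr_ge0// sqr_ge0.
rewrite ler_wpM2r ?sqr_ge0// ler_wpM2l//.
by rewrite addr_ge0// sqr_ge0.
Qed.

Lemma log_step phi t u a : t <= 0 -> u <= 0 -> `|t - u| <= a -> a <= 1 -> a <= d0 ->
  ((U (spiral_pt phi t) - U (spiral_pt phi u)) ^+ 2 +
   (T (spiral_pt phi t) - T (spiral_pt phi u)) ^+ 2) *
  (1 - gap2 (spiral_pt phi t) (spiral_pt phi u) / 4) <=
  gap2 (spiral_pt phi t) (spiral_pt phi u).
Proof.
move=> t0 u0 tu a1 ad; set p := spiral_pt phi t; set q := spiral_pt phi u.
apply: step_bound.
have : `|T p - T q| < pi / 2; last by have := @pi_gt0 R; lra.
apply: T_step; rewrite prod_normE /= ge_max (le_trans tu ad)/=.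
have -> : phi + s * t / L - (phi + s * u / L) = s * (t - u) / L by ring.
have s1 : `|s| = 1.
  by apply/eqP; rewrite -(@eqrXn2 _ 2)// expr1n real_normK ?num_real// s2.
rewrite !normrM s1 mul1r normfV (gtr0_norm L0) ler_pdivrMr//.
apply: (le_trans (le_trans tu ad)).
by rewrite ler_peMr ?(ltW d00).
Qed.

(** In logarithmic coordinates the step has length a sqrt (1 + 1/L^2), its image is
    at most L dilat times as long, and the gradient of the level has norm
    sqrt (1 + L^2).  The curvature of the coordinates and the variation of dilat
    over the step cost factors that tend to 1 with a. *)
Lemma level_step E : 1 < E -> exists2 a0, 0 < a0 &
  forall phi a t u r, a <= a0 -> t <= 0 -> u <= 0 -> r <= 0 ->
    `|t - u| <= a -> `|t - r| <= a -> `|u - r| <= a ->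
    `|level (spiral_pt phi t) - level (spiral_pt phi u)| <=
    E * (1 + L ^+ 2) * a * dilat (spiral_pt phi r).
Proof.
move=> E1; have E0 : 0 < E := lt_trans ltr01 E1.
have L2 : 1 <= L ^+ 2 := exprn_ege1 2 L1.
have Q2 : 2 <= gap_const.
  have e1 : 1 <= expR 1 :> R by rewrite -[leLHS]expR0 ler_expR.
  rewrite /gap_const -[2]mulr1; apply: ler_pM => //.
  by rewrite -[2]mulr1; apply: ler_pM => //; lra.
have lE : 0 < ln E by rewrite ln_gt0.
have iE : 0 < 1 - E^-1 by rewrite subr_gt0 invf_lt1.
pose a0 := Num.min (Num.min 1 d0) (Num.min (ln E / (3 + 2 * gap_const)) ((1 - E^-1) / gap_const)).
exists a0.
  by rewrite !lt_min ltr01 d00 !divr_gt0//; lra.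
move=> phi a t u r; rewrite !le_min => /andP[/andP[a1 ad] /andP[]].
rewrite !ler_pdivlMr; [|lra..] => aE aQ t0 u0 r0 tu tr ur.
have a_ge0 : 0 <= a := le_trans (normr_ge0 _) tu.
set p := spiral_pt phi t; set q := spiral_pt phi u; set o := spiral_pt phi r.
have iE0 : 0 < E^-1 by rewrite invr_gt0.
have aQ1 : a * gap_const <= 1 by lra.
have close v : v <= 0 -> `|v - r| <= a ->
    dilat (spiral_pt phi v) <= dilat o * expR ((1 + gap_const) * a).
  move=> v0 vr; rewrite /dilat -expRD ler_expR /=.
  have S := log_step phi v0 r0 vr a1 ad.
  have G := gap2_le_sqr phi v0 r0 vr a1.
  have G0 := gap2_ge0 (spiral_pt phi v) o.
  rewrite -/o in S G *; set g := gap2 _ _ in S G G0.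
  set x := U _ - U _ in S.
  have x2 : x ^+ 2 <= (gap_const * a) ^+ 2.
    have T0 := sqr_ge0 (T (spiral_pt phi v) - T o).
    have Qa : gap_const * a ^+ 2 <= 1.
      have : a * gap_const * a <= 1 * a by rewrite ler_wpM2r.
      lra.
    have : x ^+ 2 * (1 - g / 4) <= g.
      by apply: le_trans S; rewrite ler_wpM2r//; lra.
    nra.
  have : `|x| <= gap_const * a.
    rewrite -(@ler_pXn2r _ 2) ?nnegrE//; last by rewrite mulr_ge0//; lra.
    by rewrite real_normK ?num_real.
  rewrite ler_norml => /andP[X1 X2].
  by move: vr X1 X2; rewrite /x ler_norml => /andP[]; lra.
have G := gap2_le phi t0 u0 tu a1.
have G' := gap2_le_sqr phi t0 u0 tu a1.
have G0 := gap2_ge0 p q.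
have S := log_step phi t0 u0 tu a1 ad.
rewrite /= -/p -/q in G G' S.
have Dp := close t t0 tr; have Dq := close u u0 ur; rewrite -/p -/q in Dp Dq.
have Do0 : 0 < dilat o := expR_gt0 _.
have DD : dilat p * dilat q <= dilat o ^+ 2 * expR (2 * (1 + gap_const) * a).
  have -> : dilat o ^+ 2 * expR (2 * (1 + gap_const) * a) =
      (dilat o * expR ((1 + gap_const) * a)) * (dilat o * expR ((1 + gap_const) * a)).
    have -> : 2 * (1 + gap_const) * a = (1 + gap_const) * a + (1 + gap_const) * a by ring.
    by rewrite expRD; ring.
  by apply: ler_pM => //; exact: expR_ge0.
have eE : expR a * expR (2 * (1 + gap_const) * a) <= E.
  rewrite -expRD -[leRHS](lnK _) ?posrE// ler_expR; lra.
set g := gap2 p q in G G' G0 S.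
have gE : g <= (1 + L ^+ 2) * a ^+ 2 * dilat o ^+ 2 * E.
  apply: le_trans G _.
  have -> : (1 + L ^+ 2) * expR a * a ^+ 2 * (dilat p * dilat q) =
    (1 + L ^+ 2) * a ^+ 2 * (expR a * (dilat p * dilat q)) by ring.
  rewrite -[leRHS]mulrA; apply: ler_wpM2l.
    by rewrite mulr_ge0 ?sqr_ge0// addr_ge0// sqr_ge0.
  apply: (@le_trans _ _ (expR a * (dilat o ^+ 2 * expR (2 * (1 + gap_const) * a)))).
    by rewrite ler_wpM2l// expR_ge0.
  by rewrite mulrCA ler_wpM2l ?sqr_ge0.
set du := U p - U q in S; set dt := T p - T q in S.
have dE : (du ^+ 2 + dt ^+ 2) <= E * g.
  have h : E^-1 <= 1 - g / 4.
    have Qa : gap_const * a ^+ 2 <= gap_const * a by rewrite ler_wpM2l//; [lra|nra].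
    have Qa0 : 0 <= gap_const * a by rewrite mulr_ge0//; lra.
    lra.
  rewrite -ler_pdivrMl//; apply: le_trans S; rewrite mulrC ler_wpM2l//.
  by rewrite addr_ge0 ?sqr_ge0.
have -> : level p - level q = sg * du + L * dt by rewrite /level /du /dt; ring.
have CS : (sg * du + L * dt) ^+ 2 <= (1 + L ^+ 2) * (du ^+ 2 + dt ^+ 2).
  rewrite -{1}sg2 -subr_ge0.
  have -> : (sg ^+ 2 + L ^+ 2) * (du ^+ 2 + dt ^+ 2) - (sg * du + L * dt) ^+ 2 =
    (sg * dt - L * du) ^+ 2 by ring.
  exact: sqr_ge0.
rewrite -(@ler_pXn2r _ 2) ?nnegrE//; last first.
  by rewrite !mulr_ge0 ?addr_ge0 ?sqr_ge0 ?(ltW E0) ?expR_ge0.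
rewrite real_normK ?num_real//; apply: le_trans CS _.
have -> : (E * (1 + L ^+ 2) * a * dilat o) ^+ 2 =
  (1 + L ^+ 2) * (E * ((1 + L ^+ 2) * a ^+ 2 * dilat o ^+ 2 * E)) by ring.
rewrite ler_wpM2l ?addr_ge0 ?sqr_ge0//; apply: le_trans dE _.
by rewrite ler_wpM2l// ltW.
Qed.

Lemma sg_norm : `|sg| = 1.
Proof.
by apply/eqP; rewrite -(@eqrXn2 _ 2)// expr1n real_normK ?num_real// sg2.
Qed.

Lemma slice_dist p x v (m : int) : level p = x + 2 * pi * L * m%:~R ->
  `|polar v ((x - sg * v) / L) - img p| ^+ 2 <=
  (expR (U p) * expR `|v - U p|) ^+ 2 * (1 + L ^- 2) * (v - U p) ^+ 2.
Proof.
move=> Xp; rewrite dist_polar; set y := v - U p.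
have Lu : L \is a GRing.unit by rewrite unitfE gt_eqF.
have L_neq0 : L != 0 by rewrite gt_eqF.
have -> : (x - sg * v) / L - T p = - (sg * y / L) + 2 * pi * (- m)%:~R.
  have -> : T p = (x + 2 * pi * L * m%:~R - sg * U p) / L.
    by rewrite -Xp /level; field.
  by rewrite /y mulrNz; field.
rewrite cosD2pin cosN.
have h1 := cosh_le y; have h2 := cos_ge (sg * y / L).
have e1 : (sg * y / L) ^+ 2 = y ^+ 2 * L ^- 2.
  by rewrite !exprMn sg2 mul1r exprVn.
rewrite e1 in h2.
have ev : expR v <= expR (U p) * expR `|y|.
  by rewrite -expRD ler_expR; have := ler_norm y; rewrite /y; lra.
have y1 : 1 <= expR `|y| by rewrite -[leLHS]expR0 ler_expR.
set e := expR `|y| in h1 ev y1 *; set eU := expR (U p) in ev *.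
have U0 : 0 < eU := expR_gt0 _.
have Li : 0 <= L ^- 2 by rewrite invr_ge0 sqr_ge0.
have yy := sqr_ge0 y.
have k2 : y ^+ 2 * L ^- 2 <= y ^+ 2 * L ^- 2 * e by rewrite ler_peMr// mulr_ge0.
have H : 2 * (cosh y - cos (sg * y / L)) <= e * (1 + L ^- 2) * y ^+ 2 by lra.
have H0 : 0 <= cosh y - cos (sg * y / L).
  by have := cosh_ge1 y; have := cos_le1 (sg * y / L); lra.
have -> : 2 * expR v * eU * (cosh y - cos (sg * y / L)) =
  expR v * (eU * (2 * (cosh y - cos (sg * y / L)))) by ring.
have -> : (eU * e) ^+ 2 * (1 + L ^- 2) * y ^+ 2 =
  (eU * e) * (eU * (e * (1 + L ^- 2) * y ^+ 2)) by ring.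
apply: ler_pM => //.
  by rewrite mulr_ge0 ?(ltW U0)// mulr_ge0.
by rewrite ler_pM2l.
Qed.

(** Discs about the images of two separated points are disjoint, with radii
    proportional to the moduli of the points: this is the lower Lipschitz bound
    alone.  The discs are cut by the line where the level is x modulo the
    periods, along which the logarithm of the modulus is the parameter v. *)
Lemma slices_disjoint p q x v (m n : int) (k r E zp zq : R) :
  p.1 <= 0 -> q.1 <= 0 -> 0 < k -> k ^+ 2 = 1 + L ^- 2 -> 1 < E -> 0 <= r ->
  level p = x + 2 * pi * L * m%:~R -> level q = x + 2 * pi * L * n%:~R ->
  `|v - U p| < zp -> `|v - U q| < zq -> zp <= ln E -> zq <= ln E ->
  L * E ^+ 2 * k * zp <= r * dilat p -> L * E ^+ 2 * k * zq <= r * dilat q ->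
  r * (expR p.1 + expR q.1) <= E * `|src p - src q| -> False.
Proof.
move=> p0 q0 k0 k2 E1 r0 Xp Xq vp vq zpE zqE zpr zqr sep.
have E0 : 0 < E := lt_trans ltr01 E1.
have key o z (l : int) : level o = x + 2 * pi * L * l%:~R -> `|v - U o| < z ->
   z <= ln E -> L * E ^+ 2 * k * z <= r * dilat o ->
   L * E * `|polar v ((x - sg * v) / L) - img o| < r * expR o.1.
  move=> Xo vz zE zr; have S := slice_dist v Xo.
  set D := `|_ - img o| in S *.
  have U0 : 0 < expR (U o) := expR_gt0 _.
  have eE : expR `|v - U o| <= E.
    by rewrite -[leRHS](lnK _) ?posrE// ler_expR; lra.
  have DE : D <= expR (U o) * E * k * `|v - U o|.
    rewrite -(@ler_pXn2r _ 2) ?nnegrE//; last 2 first.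
    - exact: normr_ge0.
    - by rewrite !mulr_ge0 ?expR_ge0// ltW.
    apply: le_trans S _.
    rewrite [leRHS]exprMn real_normK ?num_real// [in leRHS]exprMn k2.
    rewrite ler_wpM2r ?sqr_ge0// ler_wpM2r//.
      by rewrite addr_ge0// invr_ge0 sqr_ge0.
    rewrite lerXn2r ?nnegrE//; rewrite ?mulr_ge0 ?expR_ge0 ?(ltW E0)//.
    by rewrite ler_pM2l.
  have Dz : D < expR (U o) * E * k * z.
    by apply: le_lt_trans DE _; rewrite ltr_pM2l// !mulr_gt0.
  have -> : r * expR o.1 = expR (U o) * (r * dilat o).
    by rewrite /dilat expRB; field; rewrite gt_eqF.
  apply: (@lt_le_trans _ _ (expR (U o) * (L * E ^+ 2 * k * z))).
    have -> : expR (U o) * (L * E ^+ 2 * k * z) =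
      L * E * (expR (U o) * E * k * z) by ring.
    by rewrite ltr_pM2l ?mulr_gt0.
  by rewrite ler_pM2l.
have Hp := key _ _ _ Xp vp zpE zpr; have Hq := key _ _ _ Xq vq zqE zqr.
set w := polar v ((x - sg * v) / L) in Hp Hq.
have tri : `|img p - img q| <= `|w - img p| + `|w - img q|.
  by rewrite [X in _ <= X + _]distrC; exact: ler_distD.
have low := img_ge p0 q0.
have LE : 0 < L * E by rewrite mulr_gt0.
have : E * `|src p - src q| <= L * E * (`|w - img p| + `|w - img q|).
  have -> : L * E * (`|w - img p| + `|w - img q|) =
    E * (L * (`|w - img p| + `|w - img q|)) by ring.
  by rewrite ler_pM2l//; apply: le_trans low _; rewrite ler_pM2l.
lra.
Qed.

(** In logarithmic coordinates neighbouring spirals are at distance d / k = 2 r,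
    because k is the secant of the inclination of the spirals.  Points of one
    spiral are compared in the same way once their moduli differ by a factor
    exp d; the integer n counts the turns between the two points. *)
Lemma separation (N : nat) (j j' t t' k E : R) :
  let d := 2 * pi / N%:R in let r := d / (2 * k) in
  (0 < N)%N -> 0 < k -> k ^+ 2 = 1 + L ^- 2 -> 1 < E -> 1 + r ^+ 2 <= E ^+ 2 ->
  (forall n : int, 1 <= `|j - j' - n%:~R * N%:R| \/
     [/\ n = 0, j = j' & d <= `|t - t'|]) ->
  r * (expR t + expR t') <=
  E * `|src (spiral_pt (d * j) t) - src (spiral_pt (d * j') t')|.
Proof.
move=> d r N0 k0 k2 E1 rE sep.
have NR : 0 < N%:R :> R by rewrite ltr0n.
have p0 := @pi_gt0 R.
have d_gt0 : 0 < d by rewrite divr_gt0// mulr_gt0.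
have r0 : 0 < r by rewrite divr_gt0// mulr_gt0.
have E0 : 0 < E := lt_trans ltr01 E1.
rewrite -(@ler_pXn2r _ 2) ?nnegrE//; last 2 first.
- by rewrite mulr_ge0 ?addr_ge0 ?expR_ge0// ltW.
- by rewrite mulr_ge0// ltW.
rewrite [(r * _) ^+ 2]exprMn [(E * _) ^+ 2]exprMn sum_polar dist_polar /=.
set psi := d * j + s * t / L - (d * j' + s * t' / L).
have [n Hn] := angle_reduce psi.
have -> : cos psi = cos (psi - 2 * pi * n%:~R).
  by rewrite -mulrN -mulrNz cosD2pin.
set psi' := psi - 2 * pi * n%:~R in Hn *; set tau := t - t'.
have E1' : psi' = d * (j - j' - n%:~R * N%:R) + s * tau / L.
  by rewrite /psi' /psi /d /tau; field; rewrite !gt_eqF.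
have four : 4 * r ^+ 2 <= tau ^+ 2 + psi' ^+ 2.
  have -> : 4 * r ^+ 2 = d ^+ 2 / k ^+ 2 by rewrite /r; field; rewrite gt_eqF.
  rewrite ler_pdivrMr ?exprn_gt0// k2.
  case: (sep n) => [far|[n0 jj dt]].
    have h : (psi' - s * tau / L) ^+ 2 <= (tau ^+ 2 + psi' ^+ 2) * (1 + L ^- 2).
      rewrite -subr_ge0.
      have -> : (tau ^+ 2 + psi' ^+ 2) * (1 + L ^- 2) - (psi' - s * tau / L) ^+ 2 =
        (tau + s * psi' / L) ^+ 2 + (1 - s ^+ 2) * (tau ^+ 2 + psi' ^+ 2) * L ^- 2.
        by field; rewrite gt_eqF.
      by rewrite s2 subrr mul0r mul0r addr0 sqr_ge0.
    apply: le_trans h; rewrite E1' addrK [leRHS]exprMn ler_peMr ?sqr_ge0//.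
    by rewrite -[leRHS]real_normK ?num_real// exprn_ege1.
  rewrite E1' n0 jj subrr mul0r subr0 mulr0 add0r.
  apply: (@le_trans _ _ (tau ^+ 2)).
    by rewrite -[leRHS]real_normK ?num_real// lerXn2r ?nnegrE// ltW.
  have Li : 0 <= L ^- 2 by rewrite invr_ge0 sqr_ge0.
  have := sqr_ge0 tau; have := sqr_ge0 (s * tau / L); nra.
have S := separation_bound Hn (sqr_ge0 r) four.
have S0 : 0 <= cosh tau - cos psi'.
  by have := cosh_ge1 tau; have := cos_le1 psi'; lra.
have tt : 0 < 2 * expR t * expR t' by rewrite !mulr_gt0 ?expR_gt0.
have S' : r ^+ 2 * (cosh tau + 1) <= E ^+ 2 * (cosh tau - cos psi').
  by apply: le_trans S _; rewrite ler_wpM2r.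
have -> : r ^+ 2 * (2 * expR t * expR t' * (cosh tau + 1)) =
  2 * expR t * expR t' * (r ^+ 2 * (cosh tau + 1)) by ring.
have -> : E ^+ 2 * (2 * expR t * expR t' * (cosh tau - cos psi')) =
  2 * expR t * expR t' * (E ^+ 2 * (cosh tau - cos psi')) by ring.
by rewrite ler_pM2l.
Qed.

Hypotheses (cU : continuous U) (cT : continuous T).

Lemma level_continuous phi : continuous (fun t => level (spiral_pt phi t)).
Proof.
move=> t.
have cs : {for t, continuous (spiral_pt phi)}.
  apply: (@pair_continuous _ _ (fun t => t) (fun t => phi + s * t / L)).
    exact: cvg_id.
  apply: cvgD; first exact: cvg_cst.
  apply: cvgM; last exact: cvg_cst.
  by apply: cvgM; [exact: cvg_cst|exact: cvg_id].
apply: (@continuous_comp _ _ _ (spiral_pt phi) level) => //.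
apply: cvgD; apply: cvgM; first [exact: cvg_cst | exact: cU | exact: cT].
Qed.

(** Each cell of a spiral is given slices, of radius proportional to the increment
    of the level over the cell, about every point of its image.  Gaps of length d
    between consecutive cells keep the slices of one spiral apart.  On the line
    of level x modulo 2 pi L the slices are disjoint intervals in the range of U,
    and a cell meets the lines for a set of x as long as its increment.
    Integration over x therefore bounds the sum of radius times increment. *)
Lemma energy_bound E : 1 < E -> E <= 2 -> exists2 a1, 0 < a1 &
  forall (N M K : nat), (0 < N)%N -> (0 < M)%N ->
    let d := 2 * pi / N%:R in let a := M%:R * d in a <= a1 ->
    \sum_(i : 'I_N * 'I_K)
      (level (spiral_pt (d * i.1%:R) (- (i.2%:R * a))) -
       level (spiral_pt (d * i.1%:R) (- (i.2.+1%:R * a) + d))) ^+ 2 <=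
    E ^+ 3 * (1 + L ^+ 2) ^+ 2 * a * N%:R * (K%:R * a + (2 * ln L + 2)).
Proof.
move=> E1 E2; have p0 := @pi_gt0 R; have p2 := @pi_ge2 R.
have E0 : 0 < E := lt_trans ltr01 E1.
have [a0 a00 step] := level_step E1.
have lE : 0 < ln E by rewrite ln_gt0.
have LL : 0 < 1 + L ^+ 2 by rewrite addr_gt0// exprn_gt0.
pose a1 := Num.min (Num.min a0 1) (Num.min (ln E) (1 + L ^+ 2)^-1).
exists a1; first by rewrite !lt_min a00 ltr01 lE invr_gt0.
move=> N M K N0 M0 d a; rewrite !le_min => /andP[/andP[aa0 al1] /andP[alE aLL]].
have NR : 0 < N%:R :> R by rewrite ltr0n.
have dE : d = 2 * pi / N%:R by [].
have aE : a = M%:R * d by [].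
clearbody a; clearbody d.
have MR : 1 <= M%:R :> R by rewrite ler1n.
have d_gt0 : 0 < d by rewrite dE divr_gt0// mulr_gt0.
have da : d <= a by rewrite aE ler_peMl// ltW.
have a_gt0 : 0 < a := lt_le_trans d_gt0 da.
pose k := Num.sqrt (1 + L ^- 2).
have Li : 0 <= L ^- 2 by rewrite invr_ge0 sqr_ge0.
have k2 : k ^+ 2 = 1 + L ^- 2 by rewrite sqr_sqrtr// addr_ge0.
have k0 : 0 < k by rewrite sqrtr_gt0 ltr_pwDl.
pose r := d / (2 * k).
have r0 : 0 < r by rewrite divr_gt0// mulr_gt0.
have k1 : 1 <= k by have := k2; nra.
have rE : 1 + r ^+ 2 <= E ^+ 2.
  have rd : r <= d by rewrite /r ler_pdivrMr ?mulr_gt0//; nra.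
  have := expR_ge1Dx (ln E); rewrite lnK ?posrE//; nra.
pose tp (i : 'I_N * 'I_K) : R := - (i.2%:R * a).
pose tm (i : 'I_N * 'I_K) : R := - (i.2.+1%:R * a) + d.
pose f (i : 'I_N * 'I_K) (t : R) := level (spiral_pt (d * i.1%:R) t).
have tmE i : tm i = tp i - a + d by rewrite /tm /tp -natr1; ring.
have tp0 i : tp i <= 0 by rewrite oppr_le0 mulr_ge0// ltW.
have tmp i : tm i <= tp i by rewrite tmE; lra.
have tmK i : - (K%:R * a) <= tm i.
  rewrite tmE /tp; have : i.2.+1%:R <= K%:R :> R by rewrite ler_nat.
  by rewrite -natr1; nra.
pose lo i := Num.min (f i (tm i)) (f i (tp i)).
pose hi i := Num.max (f i (tm i)) (f i (tp i)).
have lohi i : lo i <= hi i by rewrite ge_min le_max lexx orbC/= orbT.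
have hlE i : hi i - lo i = `|f i (tp i) - f i (tm i)|.
  rewrite /hi /lo; have [h|h] := leP (f i (tm i)) (f i (tp i)).
    by rewrite ger0_norm// subr_ge0.
  by rewrite ltr0_norm ?subr_lt0// opprB.
(* By [level_step] this makes the radii of the slices as large as
   [slices_disjoint] admits; the expression is free of k because
   k^2 = 1 + 1/L^2. *)
pose kap := d * L / (2 * E ^+ 3 * (1 + L ^+ 2) ^+ 2 * a).
have kap0 : 0 < kap.
  by rewrite divr_gt0 ?mulr_gt0 ?exprn_gt0 ?a_gt0 ?d_gt0.
pose z i := kap * (hi i - lo i).
have z0 i : 0 <= z i by rewrite mulr_ge0 ?(ltW kap0)// subr_ge0.
have cell i (q : R) : tm i <= q <= tp i -> q <= 0 /\ z i * (2 * E ^+ 2 * (1 + L ^+ 2)) <=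
    d * L * dilat (spiral_pt (d * i.1%:R) q).
  move=> /andP[q1 q2]; have q0 : q <= 0 by exact: le_trans (tp0 i).
  split=> //; have ti := tmp i; have tE := tmE i.
  have : hi i - lo i <= E * (1 + L ^+ 2) * a * dilat (spiral_pt (d * i.1%:R) q).
    rewrite hlE; apply: step => //; first exact: le_trans ti (tp0 i).
    - by apply: within_cell tE d_gt0 _ _; rewrite lexx ti.
    - by apply: within_cell tE d_gt0 _ _; rewrite ?lexx ?ti ?q1.
    - by apply: within_cell tE d_gt0 _ _; rewrite ?lexx ?ti ?q1.
  rewrite /z /kap; set D := dilat _; set X := hi i - lo i => H.
  have -> : d * L / (2 * E ^+ 3 * (1 + L ^+ 2) ^+ 2 * a) * X *
    (2 * E ^+ 2 * (1 + L ^+ 2)) = d * L * (X / (E * (1 + L ^+ 2) * a)).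
    by field; rewrite !gt_eqF.
  rewrite ler_pM2l ?mulr_gt0// ler_pdivrMr ?mulr_gt0//.
  by rewrite mulrC.
have zd i : z i <= d.
  have [q0 H] : tm i <= 0 /\ z i * (2 * E ^+ 2 * (1 + L ^+ 2)) <=
      d * L * dilat (spiral_pt (d * i.1%:R) (tm i)).
    by apply: cell; rewrite lexx tmp.
  have D := @dilat_le (spiral_pt (d * i.1%:R) (tm i)) q0.
  have E21 : 1 <= E ^+ 2 := exprn_ege1 2 (ltW E1).
  have dd : d * L * dilat (spiral_pt (d * i.1%:R) (tm i)) <= d * (1 + L ^+ 2).
    rewrite -mulrA ler_pM2l//; apply: (@le_trans _ _ (L * L)); last by lra.
    by rewrite ler_pM2l.
  have : z i * (1 * (1 + L ^+ 2)) <= z i * (2 * E ^+ 2 * (1 + L ^+ 2)).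
    by rewrite ler_wpM2l// ler_wpM2r ?(ltW LL)//; lra.
  rewrite mul1r => h; rewrite -(ler_pM2r LL).
  exact: le_trans h (le_trans H dd).
pose P := 2 * pi * L.
have P0 : 0 < P by rewrite !mulr_gt0.
pose S := K%:R * a + (2 * ln L + 2).
(* Enough periods on both sides of 0 to cover all levels that occur. *)
pose B := (Num.bound (\sum_i (`|lo i| + `|hi i|) / P)).
have HB i : - (P * B%:R) <= lo i /\ hi i <= P * B%:R.
  have s0 : 0 <= \sum_i (`|lo i| + `|hi i|) / P.
    by apply: sumr_ge0 => j _; rewrite divr_ge0 ?addr_ge0// ltW.
  have := archi_boundP s0; rewrite -/B => h.
  have h' : (`|lo i| + `|hi i|) / P <= \sum_i (`|lo i| + `|hi i|) / P.
    rewrite [leRHS](bigD1 i)//= lerDl; apply: sumr_ge0 => j _.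
    by rewrite divr_ge0 ?addr_ge0// ltW.
  have : (`|lo i| + `|hi i|) / P <= B%:R := le_trans h' (ltW h).
  rewrite ler_pdivrMr// mulrC => {h' }h1.
  exact: norms_bound.
pose J := (('I_N * 'I_K) * 'I_(B + B))%type.
pose act (x : R) (u : J) :=
  lo u.1 - P * (u.2%:R - B%:R) < x < hi u.1 - P * (u.2%:R - B%:R).
have line x : \sum_(u | act x u) 2 * z u.1 <= S.
  have [q qP] : exists q : J -> R, forall u, act x u ->
      tm u.1 <= q u <= tp u.1 /\ f u.1 (q u) = x + P * (u.2%:R - B%:R).
    suff H : forall u : J, exists t : R, act x u -> tm u.1 <= t <= tp u.1 /\
        f u.1 t = x + P * (u.2%:R - B%:R).
      by have [q qP] := choice H; exists q.
    move=> [i m].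
    have [/= xu|_] := boolP (act x (i, m)); last by exists 0.
    have [||t + tv] := @IVT R (f i) (tm i) (tp i) (x + P * (m%:R - B%:R)) (tmp i).
    - by apply: continuous_subspaceT; exact: level_continuous.
    - move: xu; rewrite /act /= ltrBlDr ltrBrDr => /andP[xl xr].
      by apply/andP; split; [exact: ltW xl|exact: ltW xr].
    by rewrite in_itv/= => tI; exists t.
  have -> : S = (ln L + 1) - (- (K%:R * a) - ln L - 1) by rewrite /S; ring.
  have lnL : 0 <= ln L by rewrite ln_ge0.
  have Ka : 0 <= K%:R * a by rewrite mulr_ge0// ltW.
  apply: (@packing R J (act x) (fun u => U (spiral_pt (d * u.1.1%:R) (q u))) (fun u => z u.1)).
  - exact: slice_range_le.
  - move=> u /qP[qI _]; have [q0 _] := cell u.1 _ qI.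
    have uc := U_close (p := spiral_pt (d * u.1.1%:R) (q u)) q0.
    move: (qI) => /andP[q1 _].
    have z1 : z u.1 <= 1 := le_trans (zd u.1) (le_trans da al1).
    by have [] := slice_range uc (le_trans (tmK u.1) q1) q0 z1; split.
  move=> [i m] [j n] v ui uj ij /= vi vj.
  have [/= qi li] := qP _ ui; have [/= qj lj] := qP _ uj.
  have [qi0 ci] := cell _ _ qi; have [qj0 cj] := cell _ _ qj.
  set qI := q (i, m) in qi li vi qi0 ci; set qJ := q (j, n) in qj lj vj qj0 cj.
  have [ieqj|ineqj] := eqVneq i j.
    subst j; have mn : m != n by move: ij; rewrite xpair_eqE eqxx.
    have h : `|f i qI - f i qJ| <= E * (1 + L ^+ 2) * a *
        dilat (spiral_pt (d * i.1%:R) qI).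
      have tE := tmE i; move: qi qj => /andP[q1 q2] /andP[q3 q4].
      have ij_a : `|qI - qJ| <= a.
        by apply: within_cell tE d_gt0 _ _; rewrite ?q1 ?q2 ?q3 ?q4.
      by apply: step; rewrite ?subrr ?normr0 ?(ltW a_gt0)// distrC.
    have D := @dilat_le (spiral_pt (d * i.1%:R) qI) qi0.
    have h2 : E * (1 + L ^+ 2) * a * dilat (spiral_pt (d * i.1%:R) qI) <= 2 * L.
      apply: ler_pM => //; first by rewrite !mulr_ge0// ?(ltW E0) ?(ltW a_gt0)// (ltW LL).
        exact: expR_ge0.
      have : (1 + L ^+ 2) * a <= 1 by rewrite -ler_pdivlMl// mulr1.
      move=> la; rewrite -mulrA -[2]mulr1; apply: ler_pM => //; first exact: ltW.
      by rewrite mulr_ge0// ltW.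
    move: h; rewrite li lj.
    have -> : x + P * (m%:R - B%:R) - (x + P * (n%:R - B%:R)) = P * (m%:R - n%:R) by ring.
    rewrite normrM gtr0_norm//.
    have : 1 <= `|m%:R - n%:R| :> R.
      have -> : m%:R - n%:R = ((m : int) - (n : int))%:~R :> R by rewrite intrB.
      rewrite -intr_norm ler1z -gtz0_ge1 normr_gt0 subr_eq0.
      by apply: contra mn => /eqP[/val_inj->].
    rewrite -(ler_pM2l P0) mulr1 => h3 h4.
    have PL : 2 * L < P by rewrite /P ltr_pM2r// ltr_pMr// (lt_le_trans _ p2)// ltr1n.
    have := lt_le_trans PL (le_trans h3 (le_trans h4 h2)).
    by rewrite ltxx.
  have zr o (oq : R) : z o * (2 * E ^+ 2 * (1 + L ^+ 2)) <=
      d * L * dilat (spiral_pt (d * o.1%:R) oq) ->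
      L * E ^+ 2 * k * z o <= r * dilat (spiral_pt (d * o.1%:R) oq).
    set D := dilat _ => h.
    have -> : r * D = k * L / (2 * (1 + L ^+ 2)) * (d * L * D).
      rewrite /r; have -> : 1 + L ^+ 2 = k ^+ 2 * L ^+ 2 by rewrite k2; field; rewrite gt_eqF.
      by field; rewrite !gt_eqF.
    have -> : L * E ^+ 2 * k * z o = k * L / (2 * (1 + L ^+ 2)) *
      (z o * (2 * E ^+ 2 * (1 + L ^+ 2))) by field; rewrite gt_eqF.
    by rewrite ler_wpM2l// divr_ge0 ?mulr_ge0// ?(ltW k0) ?(ltW L0) ?(ltW LL).
  have zE o : z o <= ln E by apply: le_trans (zd o) (le_trans da alE).
  have lvl o (oq : R) (c : 'I_(B + B)) : f o oq = x + P * (c%:R - B%:R) ->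
    level (spiral_pt (d * o.1%:R) oq) = x + 2 * pi * L * ((c : int) - (B : int))%:~R.
    by rewrite /f => ->; rewrite /P intrB.
  have sd := slices_disjoint
    (p := spiral_pt (d * i.1%:R) qI) (q := spiral_pt (d * j.1%:R) qJ) qi0 qj0 k0 k2 E1 (ltW r0)
    (lvl _ _ _ li) (lvl _ _ _ lj) vi vj (zE _) (zE _) (zr _ _ ci) (zr _ _ cj).
  apply: sd.
  have := @separation N i.1%:R j.1%:R qI qJ k E; rewrite /= -dE -/r.
  apply => // c.
  pose I1 := (i.1 : int) - (j.1 : int) - c * (N : int).
  have cE : i.1%:R - j.1%:R - c%:~R * N%:R = I1%:~R :> R by rewrite /I1 !intrB intrM.
  rewrite cE; have [I10|I1n] := eqVneq I1 0; last first.
    by left; rewrite -intr_norm ler1z -gtz0_ge1 normr_gt0.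
  right.
  have [c0 ij1] := ord_sub_multiple I10.
  split => //; first by rewrite ij1.
  have i2j2 : i.2 != j.2.
    apply: contra ineqj => /eqP e; apply/eqP.
    by move: ij1 e; clear; case: i => ? ?; case: j => ? ? /= -> ->.
  have ti := tmE i; have tj := tmE j.
  move: qi qj => /andP[qi1 qi2] /andP[qj1 qj2].
  have [lt|lt|e] := ltngtP i.2 j.2; last by case/eqP: i2j2; exact: val_inj.
    rewrite distrC; apply: (@cells_apart _ a d i.2%:R).
      apply: le_trans qj2 _; rewrite /tp lerN2 ler_pM2r// natr1 ler_nat.
      exact: lt.
    by rewrite ti in qi1.
  apply: (@cells_apart _ a d j.2%:R).
    apply: le_trans qi2 _; rewrite /tp lerN2 ler_pM2r// natr1 ler_nat.
    exact: lt.
  by rewrite tj in qj1.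
have tot : \sum_i 2 * z i * (hi i - lo i) <= S * P.
  have := @sum_overlap_le R J (fun u => 2 * z u.1)
    (fun u => lo u.1 - P * (u.2%:R - B%:R))
    (fun u => hi u.1 - P * (u.2%:R - B%:R)) 0 P S (ltW P0).
  rewrite subr0 => H; apply: le_trans (H _ _) => [|u|x _]; last exact: line.
    rewrite -(pair_bigA _ (fun i (m : 'I_(B + B)) => 2 * z i *
      Num.max 0 (Num.min (hi i - P * (m%:R - B%:R)) P -
        Num.max (lo i - P * (m%:R - B%:R)) 0)))/=.
    apply: ler_sum => i _; rewrite -mulr_sumr overlap_shift_sum//.
    + exact: (HB i).1.
    + exact: (HB i).2.
  by rewrite mulr_ge0.
have E3 : \sum_i 2 * z i * (hi i - lo i) =
    2 * kap * \sum_i (f i (tp i) - f i (tm i)) ^+ 2.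
  rewrite mulr_sumr; apply: eq_bigr => i _.
  by rewrite /z hlE -[in RHS]real_normK ?num_real//; ring.
rewrite E3 in tot.
have -> : E ^+ 3 * (1 + L ^+ 2) ^+ 2 * a * N%:R * (K%:R * a + (2 * ln L + 2)) =
    S * P / (2 * kap).
  have -> : P = d * N%:R * L by rewrite /P dE mulfVK// gt_eqF.
  rewrite /S /kap; field.
  by rewrite !gt_eqF.
by rewrite ler_pdivlMr 1?mulrC// mulr_gt0.
Qed.

End LogGeometry.

(** * Growth of the angle along a radius *)

Section Growth.
Context {R : realType}.
Local Notation V := (R * R)%type.
Variables (L : R) (U T : V -> R) (d0 C0 : R) (n : int).
Implicit Types p q : V.

Local Notation src p := (polar p.1 p.2).
Local Notation img p := (polar (U p) (T p)).

Hypotheses (L1 : 1 <= L) (d00 : 0 < d0)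
  (img_le : forall p q, p.1 <= 0 -> q.1 <= 0 ->
     `|img p - img q| <= L * `|src p - src q|)
  (img_ge : forall p q, p.1 <= 0 -> q.1 <= 0 ->
     `|src p - src q| <= L * `|img p - img q|)
  (U_close : forall p, p.1 <= 0 -> `|U p - p.1| <= ln L)
  (T_step : forall p q, `|p - q| <= d0 -> `|T p - T q| < pi / 2)
  (cU : continuous U) (cT : continuous T) (n0 : n != 0)
  (osc : forall t a b, `|T (t, a) - T (t, b) - n%:~R * (a - b)| <= C0).

Let L0 : 0 < L. Proof. exact: lt_le_trans L1. Qed.

(** U drops by S up to ln L at both ends; T drops by the rotation along the radius
    and, because the spiral turns by S / L, by n turns per turn of the spiral. *)
Lemma level_drop (sg s phi S : R) : sg ^+ 2 = 1 ->
  1 <= n%:~R * s * sg -> 0 <= S ->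
  2 * S + L * (sg * (T (0, 0) - T (- S, 0))) - 2 * ln L - 2 * (L * C0) <=
  sg * (level L U T sg (spiral_pt L s phi 0) -
        level L U T sg (spiral_pt L s phi (- S))).
Proof.
move=> sg2 nss S0.
have U1 := U_close (p := spiral_pt L s phi 0) (lexx 0).
have U2 : `|U (spiral_pt L s phi (- S)) - - S| <= ln L.
  by apply: (U_close (p := spiral_pt L s phi (- S))); rewrite /= oppr_le0.
move: U1 U2; rewrite /level /spiral_pt /= mulr0 mul0r addr0 subr0.
set phi' := phi + _.
move=> /ler_normlP[U1 U1'] /ler_normlP[U2 U2'].
have := osc 0 phi 0; have := osc (- S) 0 phi'.
set y1 := T (- S, 0) - _ - _; set y2 := T (0, phi) - _ - _ => o1 o2.
have sgn : `|sg| = 1 := sg_norm sg2.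
have b1 : - C0 <= sg * y1.
  by have : `|sg * y1| <= C0; [rewrite normrM sgn mul1r | rewrite ler_norml => /andP[]].
have b2 : - C0 <= sg * y2.
  by have : `|sg * y2| <= C0; [rewrite normrM sgn mul1r | rewrite ler_norml => /andP[]].
have E : sg * (sg * U (0, phi) + L * T (0, phi) - (sg * U (- S, phi') + L * T (- S, phi'))) =
  (sg ^+ 2) * (U (0, phi) - U (- S, phi')) + L * (sg * (T (0, 0) - T (- S, 0))) +
  L * (sg * y1) + L * (sg * y2) + n%:~R * s * sg * S.
  by rewrite /y1 /y2 /phi'; field; rewrite gt_eqF.
rewrite E sg2 mul1r.
have h1 : L * - C0 <= L * (sg * y1) by rewrite ler_pM2l.
have h2 : L * - C0 <= L * (sg * y2) by rewrite ler_pM2l.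
have h3 : 1 * S <= n%:~R * s * sg * S by rewrite ler_wpM2r.
lra.
Qed.

(** Confronts [energy_bound] with [level_drop].  The number E tends to 1 with e; a
    large M makes the gaps a small part of the cells, and a large N makes the
    cells short enough for the local estimates. *)
Lemma one_sided_growth (sg s e : R) : sg ^+ 2 = 1 -> s ^+ 2 = 1 ->
  1 <= n%:~R * s * sg -> 0 < e ->
  exists a C : R, [/\ 0 < a, a <= d0 & forall K : nat,
    sg * (T (0, 0) - T (- (K%:R * a), 0)) <= (L - L^-1 + e) * (K%:R * a) + C].
Proof.
move=> sg2 s2 nss e0; have p0 := @pi_gt0 R.
have LL : 1 <= 1 + L ^+ 2 by rewrite lerDl sqr_ge0.
have LL0 : 0 < 1 + L ^+ 2 := lt_le_trans ltr01 LL.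
have Le0 : 0 < L * e by rewrite mulr_gt0.
(* For eta <= 1, (1 + eta)^3 <= 1 + 7 eta. *)
pose eta := Num.min 1 (L * e / (7 * (1 + L ^+ 2))).
have eta0 : 0 < eta by rewrite lt_min ltr01 divr_gt0// mulr_gt0.
have eta1 : eta <= 1 by rewrite ge_min lexx.
have etaL : 7 * (1 + L ^+ 2) * eta <= L * e.
  have : eta <= L * e / (7 * (1 + L ^+ 2)) by rewrite ge_min lexx orbT.
  by rewrite ler_pdivlMr ?mulr_gt0// mulrC.
pose E := 1 + eta.
have E1 : 1 < E by rewrite ltrDl.
have E2 : E <= 2 by rewrite /E; lra.
have E3 : E ^+ 3 <= 1 + 7 * eta by rewrite /E; nra.
clearbody eta; clearbody E.
have [a0 a00 step] := level_step L1 d00 sg2 s2 img_le U_close T_step E1.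
have [a1 a10 energy] := energy_bound L1 d00 sg2 s2 img_le img_ge U_close T_step cU cT E1 E2.
pose C1 := 2 * (1 + L ^+ 2) * L.
have C10 : 0 < C1 by rewrite !mulr_gt0.
pose M := (Num.bound (2 * C1 / (L * e))).+1.
have ML : 2 * C1 <= L * e * M%:R.
  have /archi_boundP : 0 <= 2 * C1 / (L * e) by rewrite divr_ge0 ?mulr_ge0// ltW.
  rewrite -/M => h; have : 2 * C1 / (L * e) <= M%:R.
    by apply: le_trans (ltW h) _; rewrite ler_nat /M.
  by rewrite ler_pdivrMr// => {}h; rewrite [leRHS]mulrC.
have M0 : 0 < M%:R :> R by rewrite ltr0n.
pose b := Num.min (Num.min a0 a1) d0.
have b0 : 0 < b by rewrite !lt_min a00 a10.
pose N := (Num.bound (M%:R * (2 * pi) / b)).+1.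
have NM : M%:R * (2 * pi / N%:R) <= b.
  have /archi_boundP : 0 <= M%:R * (2 * pi) / b.
    by rewrite divr_ge0 ?mulr_ge0// ltW.
  move=> h; have : M%:R * (2 * pi) / b <= N%:R.
    by apply: le_trans (ltW h) _; rewrite ler_nat /N.
  rewrite ler_pdivrMr// => {}h.
  by rewrite mulrA ler_pdivrMr ?ltr0n// mulrC [leRHS]mulrC mulrC.
have N0 : 0 < N%:R :> R by rewrite ltr0n.
have := energy N M _ isT isT; cbv zeta.
set d := 2 * pi / N%:R in NM *; set a := M%:R * d in NM * => en.
have d_gt0 : 0 < d by rewrite divr_gt0// mulr_gt0.
have a_gt0 : 0 < a by rewrite mulr_gt0.
have da : d <= a by rewrite /a ler_peMl ?ler1n// ltW.
have aE : a = M%:R * d by [].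
have [ba0 ba1 bd] : [/\ a <= a0, a <= a1 & a <= d0].
  by move: NM; rewrite !le_min => /andP[/andP[? ?] ?].
clearbody a; clearbody d.
pose Cst := (E ^+ 3 * (1 + L ^+ 2) * (2 * ln L + 2) + 4 * ln L + 4 * (L * C0)) / (2 * L).
exists a, Cst; split => // K; pose S := K%:R * a; rewrite -/S.
have S0 : 0 <= S by rewrite mulr_ge0// ltW.
set G := sg * (T (0, 0) - _).
pose f (j : 'I_N) (t : R) := level L U T sg (spiral_pt L s (d * j%:R) t).
pose D := 2 * S + L * G - 2 * ln L - 2 * (L * C0).
have drop j : D <= sg * (f j 0 - f j (- S)).
  exact: level_drop.
have sgn : `|sg| = 1 := sg_norm sg2.
have row (j : 'I_N) : D - K%:R * (C1 * d) <=
    \sum_(k < K) sg * (f j (- (k%:R * a)) - f j (- (k.+1%:R * a) + d)).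
  have gaps (k : 'I_K) : sg * (f j (- (k%:R * a)) - f j (- (k.+1%:R * a))) - C1 * d <=
      sg * (f j (- (k%:R * a)) - f j (- (k.+1%:R * a) + d)).
    have t0 : - (k.+1%:R * a) + d <= 0.
      by rewrite -natr1; have : 0 <= k%:R * a; [rewrite mulr_ge0// ltW|lra].
    have t1 : - (k.+1%:R * a) <= 0 by lra.
    have h : `|f j (- (k.+1%:R * a) + d) - f j (- (k.+1%:R * a))| <=
       E * (1 + L ^+ 2) * d * dilat U (spiral_pt L s (d * j%:R) (- (k.+1%:R * a))).
      apply: step => //; first exact: le_trans da ba0.
      - by rewrite addrC addKr gtr0_norm.
      - by rewrite addrC addKr gtr0_norm.
      - by rewrite subrr normr0 ltW.
    have Dl := @dilat_le _ L U L1 U_close (spiral_pt L s (d * j%:R) (- (k.+1%:R * a))) t1.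
    have h2 : E * (1 + L ^+ 2) * d * dilat U (spiral_pt L s (d * j%:R) (- (k.+1%:R * a))) <= C1 * d.
      rewrite /C1; set dl := dilat _ _ in Dl *.
      have dl0 : 0 <= dl := expR_ge0 _.
      have -> : E * (1 + L ^+ 2) * d * dl = (1 + L ^+ 2) * d * (E * dl) by ring.
      have -> : 2 * (1 + L ^+ 2) * L * d = (1 + L ^+ 2) * d * (2 * L) by ring.
      by rewrite ler_pM2l ?mulr_gt0//; apply: ler_pM => //; lra.
    have : `|sg * (f j (- (k.+1%:R * a) + d) - f j (- (k.+1%:R * a)))| <= C1 * d.
      by rewrite normrM sgn mul1r; exact: le_trans h h2.
    move=> /ler_normlP[h3 h4]; lra.
  apply: le_trans (ler_sum _ (fun k _ => gaps k)).
  rewrite sumrB sumr_const card_ord -mulr_sumr -[C1 * d *+ K]mulr_natl.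
  have -> : \sum_(k < K) (f j (- (k%:R * a)) - f j (- (k.+1%:R * a))) = f j 0 - f j (- S).
    have := @telescope_sumr _ 0 K (fun k => - f j (- (k%:R * a))) (leq0n K).
    rewrite big_mkord mul0r oppr0 opprK => h.
    by rewrite [RHS]addrC -h; apply: eq_bigr => k _; rewrite opprK addrC.
  by rewrite lerB.
pose m := (1 + L ^+ 2) * a.
have m0 : 0 < m by rewrite mulr_gt0.
(* Cauchy-Schwarz in the linear form X^2 >= 2 m X - m^2, where m is the
   increment that every cell has in the extremal case. *)
have low : N%:R * (2 * m * (D - K%:R * (C1 * d)) - K%:R * m ^+ 2) <=
  \sum_(i : 'I_N * 'I_K) (f i.1 (- (i.2%:R * a)) - f i.1 (- (i.2.+1%:R * a) + d)) ^+ 2.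
  rewrite -(pair_bigA _ (fun j (k : 'I_K) => (f j (- (k%:R * a)) - f j (- (k.+1%:R * a) + d)) ^+ 2))/=.
  have rowE (j : 'I_N) : 2 * m * (D - K%:R * (C1 * d)) - K%:R * m ^+ 2 <=
      \sum_(k < K) (f j (- (k%:R * a)) - f j (- (k.+1%:R * a) + d)) ^+ 2.
    have q (k : 'I_K) : 2 * m * (sg * (f j (- (k%:R * a)) - f j (- (k.+1%:R * a) + d))) - m ^+ 2 <=
        (f j (- (k%:R * a)) - f j (- (k.+1%:R * a) + d)) ^+ 2.
      set X := f j _ - _; have := sqr_ge0 (sg * X - m).
      have -> : (sg * X - m) ^+ 2 = sg ^+ 2 * X ^+ 2 - 2 * m * (sg * X) + m ^+ 2 by ring.
      by rewrite sg2 mul1r; lra.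
    apply: le_trans (ler_sum _ (fun k _ => q k)).
    rewrite sumrB sumr_const card_ord -mulr_sumr -[m ^+ 2 *+ K]mulr_natl.
    by rewrite lerB// ler_pM2l ?mulr_gt0.
  have := ler_sum (index_enum 'I_N) (P := xpredT) (fun j _ => rowE j).
  by rewrite sumr_const card_ord -[_ *+ N]mulr_natl.
have {}en := le_trans low (en K ba1).
have -> : (L - L^-1 + e) * S + Cst =
  (S * (2 * (L ^+ 2 - 1) + 2 * (L * e)) +
   (E ^+ 3 * (1 + L ^+ 2) * (2 * ln L + 2) + 4 * ln L + 4 * (L * C0))) / (2 * L).
  by rewrite /Cst; field; rewrite gt_eqF.
rewrite ler_pdivlMr ?mulr_gt0//.
have lnL : 0 <= ln L by rewrite ln_ge0.
have {}en : 2 * (D - K%:R * (C1 * d)) - (1 + L ^+ 2) * S <=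
    E ^+ 3 * (1 + L ^+ 2) * (S + (2 * ln L + 2)).
  rewrite -(ler_pM2l (mulr_gt0 N0 m0)).
  have -> : N%:R * m * (2 * (D - K%:R * (C1 * d)) - (1 + L ^+ 2) * S) =
    N%:R * (2 * m * (D - K%:R * (C1 * d)) - K%:R * m ^+ 2) by rewrite /m /S; ring.
  have -> : N%:R * m * (E ^+ 3 * (1 + L ^+ 2) * (S + (2 * ln L + 2))) =
    E ^+ 3 * (1 + L ^+ 2) ^+ 2 * a * N%:R * (S + (2 * ln L + 2)) by rewrite /m; ring.
  exact: en.
have KS : 2 * (K%:R * (C1 * d)) <= L * e * S.
  rewrite /S aE.
  have -> : 2 * (K%:R * (C1 * d)) = K%:R * d * (2 * C1) by ring.
  have -> : L * e * (K%:R * (M%:R * d)) = K%:R * d * (L * e * M%:R) by ring.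
  by rewrite ler_wpM2l// mulr_ge0// ltW.
have ES : E ^+ 3 * (1 + L ^+ 2) * S <= (1 + L ^+ 2) * S + L * e * S.
  have -> : (1 + L ^+ 2) * S + L * e * S = (1 + L ^+ 2 + L * e) * S by ring.
  rewrite ler_wpM2r//.
  have : E ^+ 3 * (1 + L ^+ 2) <= (1 + 7 * eta) * (1 + L ^+ 2) by rewrite ler_pM2r.
  lra.
move: en KS ES; rewrite /D; lra.
Qed.

(** Both signs sg are covered with s the product of sg and the sign of n.  Between
    the sampled radii the angle moves by less than pi / 2. *)
Lemma angle_growth (e : R) : 0 < e -> exists C : R, forall t : R, t <= 0 ->
  `|T (t, 0) - T (0, 0)| <= (L - L^-1 + e) * - t + C.
Proof.
move=> e0; have p0 := @pi_gt0 R.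
have side (sg : R) : sg ^+ 2 = 1 -> exists C : R, forall t : R, t <= 0 ->
    sg * (T (0, 0) - T (t, 0)) <= (L - L^-1 + e) * - t + C.
  move=> sg2; pose s : R := sg * (sgz n)%:~R.
  have s2 : s ^+ 2 = 1.
    rewrite /s exprMn sg2 mul1r -rmorphXn /=.
    by move: n0; rewrite -sgz_eq0; case: (sgzP n).
  have nss : 1 <= n%:~R * s * sg.
    have -> : n%:~R * s * sg = sg ^+ 2 * (n%:~R * (sgz n)%:~R) by rewrite /s; ring.
    by rewrite sg2 mul1r -intrM ler1z mulrC -abszEsg -gtz0_ge1 ltz_nat absz_gt0.
  have [a [C [a0 ad H]]] := one_sided_growth sg2 s2 nss e0.
  exists (C + pi / 2) => t t0.
  pose K := Num.truncn (- t / a).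
  have [K1 K2] : K%:R * a <= - t /\ - t <= K%:R * a + a.
    have /truncn_itv/andP[] : 0 <= - t / a by rewrite divr_ge0 ?oppr_ge0// ltW.
    rewrite -/K -natr1 ler_pdivlMr// ltr_pdivrMr// mulrDl mul1r => k1 k2.
    by split; [|exact: ltW].
  have hT : `|T (- (K%:R * a), 0) - T (t, 0)| < pi / 2.
    apply: T_step; rewrite prod_normE /= subrr normr0 ge_max (ltW d00) andbT.
    by rewrite ler_norml; apply/andP; split; lra.
  have hs : sg * (T (- (K%:R * a), 0) - T (t, 0)) <= pi / 2.
    apply: le_trans (ler_norm _) _; rewrite normrM (sg_norm sg2) mul1r.
    exact: ltW.
  have Li : 0 <= L - L^-1 + e.
    by rewrite addr_ge0 ?(ltW e0)// subr_ge0 (le_trans _ L1)// invf_le1.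
  have := ler_wpM2l Li K1; have := H K.
  by move: (L - L^-1 + e) => g; rewrite mulrDr in hs *; lra.
have [C1 H1] := side 1 (expr1n _ _).
have [C2 H2] : exists C : R, forall t : R, t <= 0 ->
    -1 * (T (0, 0) - T (t, 0)) <= (L - L^-1 + e) * - t + C.
  by apply: side; rewrite sqrrN expr1n.
exists (Num.max C1 C2) => t t0; rewrite ler_norml; apply/andP; split.
  have := H1 t t0; have : C1 <= Num.max C1 C2 by rewrite le_max lexx.
  lra.
have := H2 t t0; have : C2 <= Num.max C1 C2 by rewrite le_max lexx orbT.
lra.
Qed.

End Growth.

(** * Limits superior and rates of rotation *)

Section LimSup.
Context {R : realType}.
Implicit Types f g : R -> R.
Local Notation esup f := (limf_esup (fun r : R => (f r)%:E) 0^'+).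
Local Notation einf f := (limf_einf (fun r : R => (f r)%:E) 0^'+).

Lemma esup_le f g :
  (forall e, 0 < e -> \forall r \near 0^'+, f r <= g r + e) ->
  (esup f <= esup g)%E.
Proof.
move=> fg; rewrite [leRHS]limf_esupE; apply: le_ereal_inf_tmp => _ [A FA <-].
apply/lee_addgt0Pr => e e0; rewrite limf_esupE.
have FB := filterI FA (fg e e0).
set B := A `&` _ in FB.
apply: (@le_trans _ _ (ereal_sup [set (f r)%:E | r in B])).
  by apply: ereal_inf_lbound; exists B; first exact: FB.
apply: ge_ereal_sup => _ [r [Ar fr] <-].
apply: (@le_trans _ _ ((g r)%:E + e%:E)%E); first by rewrite -EFinD lee_fin.
by rewrite leeD2r//; apply: ereal_sup_ubound; exists r.
Qed.

Lemma esup_cst (c : R) : esup (fun=> c) = c%:E.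
Proof.
apply/eqP; rewrite eq_le; apply/andP; split.
  rewrite limf_esupE; apply: (@le_trans _ _ (ereal_sup [set c%:E | r in [set: R]])).
    by apply: ereal_inf_lbound; exists setT => //; exact: filterT.
  by apply: ge_ereal_sup => _ [r _ <-].
rewrite limf_esupE; apply: le_ereal_inf_tmp => _ [A FA <-].
have [r Ar] := filter_ex FA.
by apply: ereal_sup_ubound; exists r.
Qed.

Lemma einfE f : einf f = (- esup (fun r => - f r))%E.
Proof. by []. Qed.

Lemma esup_near_eq f g :
  (forall e, 0 < e -> \forall r \near 0^'+, `|f r - g r| <= e) ->
  esup f = esup g.
Proof.
move=> fg; apply/eqP; rewrite eq_le; apply/andP; split; apply: esup_le => e e0;
  near=> r; have : `|f r - g r| <= e by near: r; exact: fg.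
- by rewrite ler_norml => /andP[]; lra.
- by rewrite ler_norml => /andP[]; lra.
Unshelve. all: by end_near. Qed.

Lemma einf_near_eq f g :
  (forall e, 0 < e -> \forall r \near 0^'+, `|f r - g r| <= e) ->
  einf f = einf g.
Proof.
move=> fg; rewrite !einfE; congr (- _)%E; apply: esup_near_eq => e e0.
by near=> r; rewrite -opprD normrN; near: r; exact: fg.
Unshelve. all: by end_near. Qed.

Lemma abse_esup_le f (K : R) :
  (forall e, 0 < e -> \forall r \near 0^'+, `|f r| <= K + e) ->
  (`|esup f| <= K%:E)%E.
Proof.
move=> fK.
have le1 : (esup f <= K%:E)%E.
  rewrite -esup_cst; apply: esup_le => e e0; near=> r.
  have : `|f r| <= K + e by near: r; exact: fK.
  by rewrite ler_norml => /andP[].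
have le2 : ((- K)%:E <= esup f)%E.
  rewrite -esup_cst; apply: esup_le => e e0; near=> r.
  have : `|f r| <= K + e by near: r; exact: fK.
  by rewrite ler_norml => /andP[]; lra.
by move: le1 le2; case: limf_esup => //= s; rewrite !lee_fin ler_norml => -> ->.
Unshelve. all: by end_near. Qed.

Lemma abse_einf_le f (K : R) :
  (forall e, 0 < e -> \forall r \near 0^'+, `|f r| <= K + e) ->
  (`|einf f| <= K%:E)%E.
Proof.
move=> fK; rewrite einfE abseN; apply: abse_esup_le => e e0.
by near=> r; rewrite normrN; near: r; exact: fK.
Unshelve. all: by end_near. Qed.

End LimSup.

Section Rates.
Context {R : realType}.
Implicit Types (f : Rcomplex R -> Rcomplex R) (z : Rcomplex R).

Lemma ln_quotient_small (c e : R) : 0 < e -> exists2 x, 0 < x &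
  forall r, 0 < r < x -> `|c| <= e * - ln r /\ 0 < - ln r.
Proof.
move=> e0; exists (expR (- (`|c| / e + 1))); first exact: expR_gt0.
move=> r /andP[r0 rx].
have : ln r < - (`|c| / e + 1) by rewrite -[ltRHS]expRK ltr_ln ?posrE// expR_gt0.
rewrite ltrNr => h; have ce : 0 <= `|c| / e by rewrite divr_ge0// ltW.
split; last by lra.
by rewrite mulrC -ler_pdivrMr//; lra.
Qed.

Lemma near0_itv (P : R -> Prop) (x : R) : 0 < x ->
  (forall r, 0 < r < x -> P r) -> \forall r \near 0^'+, P r.
Proof.
move=> x0 H; near=> r; apply: H; apply/andP; split.
  by near: r; exact: nbhs_right_gt.
by near: r; exact: nbhs_right_lt.
Unshelve. all: by end_near. Qed.

Lemma arg_branch_unique f z th1 th2 (e0 : R) : 0 < e0 ->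
  (forall r : R, 0 < r < e0 -> f (z + r%:A) != f z) ->
  arg_branch f z th1 -> arg_branch f z th2 ->
  exists c, exists2 x : R, 0 < x & forall r, 0 < r < x -> th1 r = th2 r + c.
Proof.
move=> e00 fz [e1 e10 [c1 H1]] [e2 e20 [c2 H2]].
pose x := Num.min e0 (Num.min e1 e2).
have x0 : 0 < x by rewrite !lt_min e00 e10.
have sub r : 0 < r < x -> [/\ 0 < r < e0, 0 < r < e1 & 0 < r < e2].
  by rewrite !lt_min => /andP[-> /andP[-> /andP[-> ->]]].
pose g r := th1 r - th2 r.
have gZ r : 0 < r < x -> exists m : int, g r = 2 * pi * m%:~R.
  move=> /sub[r0 r1 r2].
  have n0 : 0 < `|f (z + r%:A) - f z| by rewrite normr_gt0 subr_eq0 fz.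
  have E : `|f (z + r%:A) - f z| *: expi (th1 r) = `|f (z + r%:A) - f z| *: expi (th2 r).
    by rewrite -H1// -H2.
  by have [m E'] := scale_expi_eq n0 n0 E; exists m; rewrite /g E'; ring.
have cst a b : 0 < a -> a <= b -> b < x -> g b = g a.
  move=> a0 ab bx; apply: int_valued_const => //.
    apply: continuous_in_subspaceT => r; rewrite inE /= in_itv/= => /andP[ar rb].
    have rI : 0 < r < x by rewrite (lt_le_trans a0 ar) (le_lt_trans rb bx).
    have [_ r1 r2] := sub r rI.
    by apply: cvgB; [apply: c1|apply: c2]; rewrite in_itv.
  move=> r /andP[ar rb].
  have [|m ->] := gZ r; first by rewrite (lt_le_trans a0 ar) (le_lt_trans rb bx).
  have [|k ->] := gZ a; first by rewrite a0 (le_lt_trans ab bx).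
  by exists (m - k); rewrite intrB; ring.
have x2 : 0 < x / 2 by rewrite divr_gt0.
exists (g (x / 2)), (x / 2) => // r /andP[r0 rx].
rewrite (cst r (x / 2))//; [|exact: ltW|by lra].
by rewrite /g; ring.
Qed.

(** Two branches differ by a constant near 0, which is negligible against ln r. *)
Lemma rates_of_branch f z th (e0 : R) : 0 < e0 ->
  (forall r : R, 0 < r < e0 -> f (z + r%:A) != f z) -> arg_branch f z th ->
  upper_rate f z = limf_esup (fun r : R => (th r / ln r)%:E) 0^'+ /\
  lower_rate f z = limf_einf (fun r : R => (th r / ln r)%:E) 0^'+.
Proof.
move=> e00 fz thB.
have close th' : arg_branch f z th' -> forall e, 0 < e ->
    \forall r \near 0^'+, `|th' r / ln r - th r / ln r| <= e.
  move=> thB' e e_gt0.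
  have [c [x x0 xP]] := arg_branch_unique e00 fz thB' thB.
  have [y y0 yP] := ln_quotient_small c e_gt0.
  apply: (@near0_itv _ (Num.min x y)); first by rewrite lt_min x0.
  move=> r; rewrite lt_min => /andP[r0 /andP[rx ry]].
  have [yc lr] : `|c| <= e * - ln r /\ 0 < - ln r by apply: yP; rewrite r0.
  rewrite xP ?r0// -mulrBl addrC addKr normrM normfV.
  have -> : `|ln r| = - ln r by rewrite ler0_norm// -oppr_ge0 ltW.
  by rewrite ler_pdivrMr.
split; rewrite /upper_rate /lower_rate.
- have H : is_upper_rate f z (limf_esup (fun r : R => (th r / ln r)%:E) 0^'+).
    split; first by exists th.
    by move=> th' thB'; apply: esup_near_eq; exact: close.
  by have [_ ->] := @xgetPex _ +oo%E [set g | is_upper_rate f z g] (ex_intro _ _ H).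
- have H : is_lower_rate f z (limf_einf (fun r : R => (th r / ln r)%:E) 0^'+).
    split; first by exists th.
    by move=> th' thB'; apply: einf_near_eq; exact: close.
  by have [_ ->] := @xgetPex _ +oo%E [set g | is_lower_rate f z g] (ex_intro _ _ H).
Qed.

End Rates.

(** * The bound for bilipschitz homeomorphisms *)

Section RotationBound.
Context {R : realType}.

Section Normalized.
Variables (L rho : R) (h : Rcomplex R -> Rcomplex R).
Hypotheses (L1 : 1 <= L) (rho0 : 0 < rho) (h0 : h 0 = 0)
  (hbil : bilipschitz_on L [set z | `|z| <= 1] h)
  (hsurj : forall w : Rcomplex R, `|w| <= rho ->
     exists2 z : Rcomplex R, `|z| <= 1 & h z = w).

Lemma normalized_branch : exists th : R -> R, [/\ continuous th,
  forall t, t <= 0 -> h (polar t 0) = `|h (polar t 0)| *: expi (th t) &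
  forall e, 0 < e -> exists C : R, forall t, t <= 0 ->
    `|th t - th 0| <= (L - L^-1 + e) * - t + C].
Proof.
have L0 : 0 < L := lt_le_trans ltr01 L1.
have [U [T [d [C [n [[d0 n0 cU cT] FE step osc]]]]]] :=
  exists_log_map L1 rho0 h0 hbil hsurj.
have FE' (p : R * R) : p.1 <= 0 -> polar (U p) (T p) = h (polar p.1 p.2).
  by move=> p0; rewrite -FE /disk_pt min_l.
have le1 (p : R * R) : p.1 <= 0 -> `|polar p.1 p.2| <= 1.
  by move=> p0; rewrite norm_polar expR_le1.
exists (fun t => T (t, 0)); split.
- move=> t.
  have ct : {for t, continuous (fun t : R => (t, 0 : R))}.
    apply: (@pair_continuous _ _ (fun t : R => t) (fun=> 0)).
      exact: cvg_id.
    exact: cvg_cst.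
  by apply: (@continuous_comp _ _ _ (fun t : R => (t, 0 : R)) T);
    [exact: ct|exact: cT].
- move=> t t0; have E := FE' (t, 0) t0; rewrite /= in E.
  by rewrite -E norm_polar.
move=> e e0; apply: (angle_growth L1 d0 _ _ _ step cU cT n0 osc e0).
- move=> p q p0 q0; rewrite !FE'//.
  by have [] := hbil (le1 p p0) (le1 q q0).
- move=> p q p0 q0; rewrite !FE'//.
  by have [+ _] := hbil (le1 p p0) (le1 q q0); rewrite ler_pdivrMl.
- move=> p p0.
  have [] := modulus_bounds h0 hbil (le1 p p0); rewrite -FE'// !norm_polar => H1 H2.
  rewrite ler_norml; apply/andP; split.
    by rewrite -ler_expR expRN expRB lnK ?posrE// ler_pdivlMr ?expR_gt0.
  by rewrite -ler_expR expRB lnK ?posrE// ler_pdivrMr ?expR_gt0.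
Qed.

End Normalized.

Lemma ball_norm (A : set (Rcomplex R)) (z : Rcomplex R) : open A -> A z ->
  exists2 r : R, 0 < r & forall w, `|w - z| <= r -> A w.
Proof.
move=> oA Az; have /nbhs_normP[r r0 rA] : nbhs z A by exact: open_nbhs_nbhs.
exists (r / 2); first by rewrite divr_gt0.
move=> w wz; apply: rA; rewrite /= distrC (le_lt_trans wz)//.
by rewrite ltr_pdivrMr// ltr_pMr// ltr1n.
Qed.

Lemma polar_ln (r : R) : 0 < r -> polar (ln r) 0 = r%:A.
Proof.
move=> r0; rewrite /polar lnK ?posrE//; congr (_ *: _).
by rewrite /expi cos0 sin0.
Qed.

(** A small disc about z is rescaled to the unit disc.  Its image contains a disc
    because V is open and the inverse of f is L-Lipschitz. *)
Lemma branch_growth (L : R) (U V : set (Rcomplex R)) f z : 1 <= L ->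
  open U -> open V -> set_bij U V f -> bilipschitz_on L U f -> U z ->
  exists th, arg_branch f z th /\ forall e, 0 < e ->
    \forall r \near 0^'+, `|th r / ln r| <= L - L^-1 + e.
Proof.
move=> L1 oU oV [fUV fI fS] bil Uz.
have L0 : 0 < L := lt_le_trans ltr01 L1.
have [r0 r00 rU] := ball_norm oU Uz.
have [r1 r10 rV] := ball_norm oV (fUV _ Uz).
pose h (w : Rcomplex R) : Rcomplex R := r0^-1 *: (f (z + r0 *: w) - f z).
have inU (w : Rcomplex R) : `|w| <= 1 -> U (z + r0 *: w).
  move=> w1; apply: rU; rewrite addrC addKr normrZ gtr0_norm//.
  by rewrite ler_piMr// ltW.
have h0 : h 0 = 0 by rewrite /h scaler0 addr0 subrr scaler0.
have hbil : bilipschitz_on L [set w | `|w| <= 1] h.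
  move=> x y x1 y1; have [b1 b2] := bil _ _ (inU x x1) (inU y y1).
  have E1 : h x - h y = r0^-1 *: (f (z + r0 *: x) - f (z + r0 *: y)).
    by rewrite /h -scalerBr opprB addrA subrK.
  have E2 : z + r0 *: x - (z + r0 *: y) = r0 *: (x - y).
    by rewrite opprD addrACA subrr add0r scalerBr.
  rewrite E2 normrZ gtr0_norm// in b1 b2.
  rewrite E1 normrZ gtr0_norm ?invr_gt0//; split.
    by rewrite ler_pdivlMl// mulrCA.
  by rewrite ler_pdivrMl// mulrCA.
(* Preimages under h of points of modulus at most 1/L lie in the unit disc. *)
pose rho := Num.min L^-1 (r1 / r0).
have rho0 : 0 < rho by rewrite lt_min invr_gt0 L0 divr_gt0.
have hsurj (w : Rcomplex R) : `|w| <= rho -> exists2 x : Rcomplex R, `|x| <= 1 & h x = w.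
  rewrite le_min => /andP[wL wr].
  have Vw : V (f z + r0 *: w).
    apply: rV; rewrite addrC addKr normrZ gtr0_norm//.
    by rewrite mulrC -ler_pdivlMr.
  have [y Uy fy] := fS _ Vw.
  have [b1 _] := bil _ _ Uy Uz.
  exists (r0^-1 *: (y - z)); last first.
    by rewrite /h scalerA mulfV ?gt_eqF// scale1r [z + _]addrC subrK fy
      addrC addKr scalerA mulVf ?gt_eqF// scale1r.
  rewrite normrZ gtr0_norm ?invr_gt0// ler_pdivrMl// mulr1.
  rewrite fy [f z + _]addrC addrK normrZ (gtr0_norm r00) ler_pdivrMl// in b1.
  apply: le_trans b1 _; rewrite mulrCA ler_piMr ?(ltW r00)//.
  by rewrite -ler_pdivlMl// mulr1.
have [t [ct tE tG]] := normalized_branch L1 rho0 h0 hbil hsurj.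
have lnE (r : R) : 0 < r -> ln (r / r0) = ln r - ln r0.
  by move=> r_gt0; rewrite ln_div ?posrE.
have ln_le (r : R) : 0 < r < r0 -> ln (r / r0) <= 0.
  by move=> /andP[r_gt0 rr0]; rewrite ln_le0// ler_pdivrMr// mul1r ltW.
exists (fun r => t (ln (r / r0))); split.
  exists r0 => //; split.
    move=> r; rewrite in_itv/= => /andP[r_gt0 rr0].
    have cl : {for r, continuous (fun r : R => ln (r / r0))}.
      have cm : {for r, continuous (fun r : R => r / r0)}.
        by apply: cvgM; [exact: cvg_id|exact: cvg_cst].
      by apply: (@continuous_comp _ _ _ (fun r : R => r / r0) (@ln R));
        [exact: cm|apply: continuous_ln; rewrite divr_gt0].
    by apply: (@continuous_comp _ _ _ (fun r : R => ln (r / r0)) t);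
      [exact: cl|exact: ct].
  move=> r rI; have /andP[r_gt0 rr0] := rI.
  have E := tE _ (ln_le r rI); rewrite polar_ln ?divr_gt0// in E.
  have E' : f (z + r%:A) - f z = r0 *: h (r / r0)%:A.
    rewrite /h !scalerA mulfV ?gt_eqF// scale1r; congr (f (z + _) - _).
    by rewrite -[r0 * _]mulrC divfK ?gt_eqF.
  by rewrite E' normrZ gtr0_norm// {1}E scalerA.
move=> e e0; have e2 : 0 < e / 2 by rewrite divr_gt0.
have [C CP] := tG _ e2.
pose K := L - L^-1 + e / 2.
have [x x0 xP] := ln_quotient_small (`|K * ln r0| + `|t 0| + `|C|) e2.
apply: (@near0_itv _ _ (Num.min x r0)); first by rewrite lt_min x0.
move=> r; rewrite lt_min => /andP[r_gt0 /andP[rx rr0]].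
have [|xc lr] := xP r; first by rewrite r_gt0.
have rI : 0 < r < r0 by rewrite r_gt0.
have := CP _ (ln_le r rI); rewrite lnE// -/K => H.
rewrite normrM normfV (_ : `|ln r| = - ln r); last first.
  by rewrite ler0_norm// -oppr_ge0 ltW.
rewrite ler_pdivrMr//.
have tri : `|t (ln r - ln r0)| <= `|t (ln r - ln r0) - t 0| + `|t 0|.
  by rewrite -{1}(subrK (t 0) (t (ln r - ln r0))) ler_normD.
have xc' : `|K * ln r0| + `|t 0| + `|C| <= e / 2 * - ln r.
  by apply: le_trans xc; exact: ler_norm.
have := ler_norm (K * ln r0); have := ler_norm C.
have -> : (L - L^-1 + e) * - ln r = K * - ln r + e / 2 * - ln r.
  by rewrite /K; field; rewrite gt_eqF.
rewrite opprB mulrBr in H; clearbody K.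
by lra.
Qed.

Lemma rotation_bound (L : R) (U V : set (Rcomplex R)) f z : 1 <= L ->
  open U -> open V -> set_bij U V f -> bilipschitz_on L U f -> U z ->
  (`|upper_rate f z| <= (L - L^-1)%:E)%E /\
  (`|lower_rate f z| <= (L - L^-1)%:E)%E.
Proof.
move=> L1 oU oV fUV bil Uz.
have [th [thB thG]] := branch_growth L1 oU oV fUV bil Uz.
have [r0 r00 rU] := ball_norm oU Uz.
have fz (r : R) : 0 < r < r0 -> f (z + r%:A) != f z.
  move=> /andP[r_gt0 rr0]; have [_ fI _] := fUV.
  have Ur : U (z + r%:A).
    apply: rU; rewrite addrC addKr -polar_ln// norm_polar lnK ?posrE//.
    exact: ltW.
  apply/eqP => /(fI _ _ (mem_set Ur) (mem_set Uz))/eqP.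
  rewrite -subr_eq0 addrC addKr -polar_ln//.
  by rewrite -normr_eq0 norm_polar expR_eq0.
have [-> ->] := rates_of_branch r00 fz thB.
by split; [exact: abse_esup_le|exact: abse_einf_le].
Qed.

End RotationBound.

(** * The spiral map *)

Section Spiral.
Context {R : realType}.
Implicit Types (z w : Rcomplex R) (gamma t a : R).

Lemma mul_expi (a b : R) : expi a * expi b = expi (a + b).
Proof. by rewrite /expi cosD sinD [sin a * cos b + _]addrC. Qed.

Lemma spiral_polar gamma t a :
  spiral gamma (polar t a) = polar t (a + gamma * t).
Proof. by rewrite /spiral norm_polar expRK /polar -scalerAl mul_expi. Qed.

Lemma spiral0 gamma : spiral gamma 0 = 0.
Proof. by rewrite /spiral mul0r. Qed.

Lemma polarP z : z != 0 -> exists t a, z = polar t a.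
Proof.
move=> z0; have [a E] := polar_form z; exists (ln `|z|), a.
by rewrite /polar lnK ?posrE ?normr_gt0.
Qed.

Lemma norm_spiral gamma z : `|spiral gamma z| = `|z|.
Proof.
have [->|/polarP[t [a ->]]] := eqVneq z 0; first by rewrite spiral0.
by rewrite spiral_polar !norm_polar.
Qed.

Lemma spiralK gamma : cancel (spiral gamma) (spiral (- gamma)).
Proof.
move=> z; have [->|/polarP[t [a ->]]] := eqVneq z 0; first by rewrite !spiral0.
by rewrite !spiral_polar mulNr addrK.
Qed.

(** As a function of psi, L^2 cos psi - cos (psi + b) has amplitude
    |L^2 - exp (i b)|, whose square (L^2 - 1)^2 + 2 L^2 (1 - cos b) is at most
    (L^2 - 1)^2 + L^2 b^2.  For b = gamma tau this is (L^2 - 1)^2 (1 + tau^2),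
    and 1 + tau^2 <= cosh^2 tau. *)
Lemma spiral_stretch (L gamma tau psi : R) : 1 <= L -> L * `|gamma| = L ^+ 2 - 1 ->
  cosh tau - cos (psi + gamma * tau) <= L ^+ 2 * (cosh tau - cos psi).
Proof.
move=> L1 LE; set b := gamma * tau.
have L2 : 1 <= L ^+ 2 := exprn_ege1 2 L1.
suff : L ^+ 2 * cos psi - cos (psi + b) <= (L ^+ 2 - 1) * cosh tau by lra.
set X := _ - _; set Y := _ * cosh tau.
have Y0 : 0 <= Y by rewrite mulr_ge0 ?(ltW (cosh_gt0 _))// subr_ge0.
apply: le_trans (ler_norm _) _; rewrite -(@ler_pXn2r _ 2) ?nnegrE//.
rewrite real_normK ?num_real//.
have XE : X = (L ^+ 2 - cos b) * cos psi + sin b * sin psi.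
  by rewrite /X cosD; ring.
have h1 : X ^+ 2 <= (L ^+ 2 - cos b) ^+ 2 + sin b ^+ 2.
  have -> : (L ^+ 2 - cos b) ^+ 2 + sin b ^+ 2 =
    ((L ^+ 2 - cos b) ^+ 2 + sin b ^+ 2) * (cos psi ^+ 2 + sin psi ^+ 2).
    by rewrite cos2Dsin2 mulr1.
  rewrite XE -subr_ge0.
  have -> : ((L ^+ 2 - cos b) ^+ 2 + sin b ^+ 2) * (cos psi ^+ 2 + sin psi ^+ 2) -
    ((L ^+ 2 - cos b) * cos psi + sin b * sin psi) ^+ 2 =
    ((L ^+ 2 - cos b) * sin psi - sin b * cos psi) ^+ 2 by ring.
  exact: sqr_ge0.
apply: le_trans h1 _.
have h2 : 1 - cos b <= b ^+ 2 / 2 by have := cos_ge b; lra.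
have h3 : (L ^+ 2 - cos b) ^+ 2 + sin b ^+ 2 =
    (L ^+ 2 - 1) ^+ 2 + 2 * L ^+ 2 * (1 - cos b).
  by rewrite sin2cos2; ring.
have h4 : L ^+ 2 * b ^+ 2 = (L ^+ 2 - 1) ^+ 2 * tau ^+ 2.
  by rewrite /b exprMn -LE exprMn real_normK ?num_real//; ring.
have h5 : (L ^+ 2 - 1) ^+ 2 * (1 + tau ^+ 2) <= Y ^+ 2.
  by rewrite /Y exprMn ler_wpM2l ?sqr_ge0// sqr_cosh_ge.
have h6 : 2 * L ^+ 2 * (1 - cos b) <= L ^+ 2 * b ^+ 2.
  have : L ^+ 2 * (1 - cos b) <= L ^+ 2 * (b ^+ 2 / 2) by rewrite ler_wpM2l ?sqr_ge0.
  lra.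
by rewrite h3; lra.
Qed.

Lemma spiral_lipschitz (L gamma : R) z w : 1 <= L -> L * `|gamma| = L ^+ 2 - 1 ->
  `|spiral gamma z - spiral gamma w| <= L * `|z - w|.
Proof.
move=> L1 LE.
have [->|z0] := eqVneq z 0.
  by rewrite spiral0 !sub0r !normrN norm_spiral ler_peMl.
have [->|w0] := eqVneq w 0.
  by rewrite spiral0 !subr0 norm_spiral ler_peMl.
have [t [a ->]] := polarP z0; have [u [b ->]] := polarP w0.
rewrite !spiral_polar -(@ler_pXn2r _ 2) ?nnegrE ?mulr_ge0// ?(le_trans ler01)//.
rewrite exprMn !dist_polar.
have -> : a + gamma * t - (b + gamma * u) = (a - b) + gamma * (t - u) by ring.
have S := @spiral_stretch L gamma (t - u) (a - b) L1 LE.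
rewrite [leRHS]mulrCA ler_pM2l//.
by rewrite !mulr_gt0 ?expR_gt0.
Qed.

Lemma lipschitz_continuous (L : R) (f : Rcomplex R -> Rcomplex R) : 0 < L ->
  (forall z w, `|f z - f w| <= L * `|z - w|) -> continuous f.
Proof.
move=> L0 H z; have FF : Filter (nbhs z) by exact: nbhs_filter.
apply/(@cvgrPdist_lt _ _ _ (nbhs z) FF) => e e0.
apply/nbhs_normP; exists (e / L); first by rewrite /= divr_gt0.
move=> w /= zw; apply: le_lt_trans (H z w) _.
by rewrite mulrC -ltr_pdivlMr.
Qed.

Lemma spiral_rates gamma :
  upper_rate (spiral gamma) 0 = gamma%:E /\
  lower_rate (spiral gamma) 0 = gamma%:E.
Proof.
have sE (r : R) : 0 < r -> spiral gamma (0 + r%:A) = r *: expi (gamma * ln r).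
  by move=> r0; rewrite add0r -polar_ln// spiral_polar add0r /polar lnK.
have sB : arg_branch (spiral gamma) 0 (fun r => gamma * ln r).
  exists 1 => //; split=> r.
    rewrite in_itv/= => /andP[r0 _]; apply: cvgM; first exact: cvg_cst.
    exact: continuous_ln.
  move=> /andP[r0 _]; rewrite spiral0 subr0 sE// normrZ norm_expi mulr1.
  by rewrite gtr0_norm.
have s0 (r : R) : 0 < r < 1 -> spiral gamma (0 + r%:A) != spiral gamma 0.
  move=> /andP[r0 _]; rewrite spiral0 sE// -normr_eq0 normrZ norm_expi mulr1.
  by rewrite normr_eq0 gt_eqF.
have near_c e : 0 < e -> \forall r \near 0^'+, `|gamma * ln r / ln r - gamma| <= e.
  move=> e0; apply: (@near0_itv _ _ 1) => // r r01.
  by rewrite mulfK ?subrr ?normr0 ?(ltW e0)// lt_eqF// ln_lt0.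
have [-> ->] := rates_of_branch ltr01 s0 sB.
rewrite (esup_near_eq near_c) (einf_near_eq near_c) einfE !esup_cst.
by rewrite EFinN oppeK.
Qed.

End Spiral.

Theorem proposition6p1 (R : realType) :
  (forall (L : R) (U V : set (Rcomplex R)) (f : Rcomplex R -> Rcomplex R),
     1 <= L ->
     planar_domain U -> planar_domain V ->
     homeomorphism_on U V f ->
     bilipschitz_on L U f ->
     forall z : Rcomplex R, U z ->
       (`|upper_rate f z| <= (L - L^-1)%:E)%E /\
       (`|lower_rate f z| <= (L - L^-1)%:E)%E)
  /\
  (forall gamma : R, exists L : R,
     [/\ 1 <= L /\ L - L^-1 = `|gamma|,
         homeomorphism_on (@unit_disk R) (@unit_disk R) (spiral gamma),
         bilipschitz_on L (@unit_disk R) (spiral gamma),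
         (`|upper_rate (spiral gamma) 0%R| = (L - L^-1)%:E)%E &
         (`|lower_rate (spiral gamma) 0%R| = (L - L^-1)%:E)%E]).
Proof.
split=> [L U V f L1 [_ oU _] [_ oV _] [fUV _ _] bil z Uz|gamma].
  exact: rotation_bound oU oV fUV bil Uz.
pose D := Num.sqrt (`|gamma| ^+ 2 + 4).
have D2 : D ^+ 2 = `|gamma| ^+ 2 + 4 by rewrite sqr_sqrtr// addr_ge0// sqr_ge0.
have D0 : 0 <= D := sqrtr_ge0 _.
have g0 := normr_ge0 gamma.
(* The positive root of L^2 - |gamma| L - 1. *)
pose L := (`|gamma| + D) / 2.
have LE : L * `|gamma| = L ^+ 2 - 1 by rewrite /L; nra.
have L1 : 1 <= L by rewrite /L; nra.
have L0 : 0 < L := lt_le_trans ltr01 L1.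
have LV : L - L^-1 = `|gamma|.
  apply: (mulfI (lt0r_neq0 L0)).
  by rewrite mulrBr mulfV ?lt0r_neq0// LE expr2.
have LE' : L * `|- gamma| = L ^+ 2 - 1 by rewrite normrN.
have lip z w := @spiral_lipschitz R L gamma z w L1 LE.
have lipV z w := @spiral_lipschitz R L (- gamma) z w L1 LE'.
have cs := lipschitz_continuous L0 lip.
have csV := lipschitz_continuous L0 lipV.
have sKV : cancel (spiral (- gamma)) (@spiral R gamma).
  by have := @spiralK R (- gamma); rewrite opprK.
have [ur lr] := @spiral_rates R gamma.
exists L; split=> //.
- split; last first.
  + exists (spiral (- gamma)) => [z _|]; first exact: spiralK.
    exact: continuous_subspaceT.
  + exact: continuous_subspaceT.
  + split=> [z|z w _ _|z] /=.
    * by rewrite /unit_disk /= norm_spiral.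
    * exact: can_inj (@spiralK R gamma) _ _.
    * move=> z1; exists (spiral (- gamma) z); last exact: sKV.
      by rewrite /unit_disk /= norm_spiral.
- move=> z w _ _; split=> //; rewrite ler_pdivrMl//.
  by have := lipV (spiral gamma z) (spiral gamma w); rewrite !spiralK.
- by rewrite ur LV.
- by rewrite lr LV.
Qed.
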